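(* Let $(K,v)$ be a valued field of characteristic $0$ with residue field $\overline{K}$ of characteristic $0$, regarded as an $\mathcal{L}_{Mac}$-structure in the natural way. Suppose that the complete theory $\mathrm{Th}(K)$ of $K$ in $\mathcal{L}_{Mac}$ admits quantifier elimination and that $(K,v)$ is of prohenselian degree $2$. Then $v$ is henselian.
   Context: All valuation rings are proper subrings of their fields. For a valued field $(L,w)$ let $\mathcal{O}$ be its valuation ring and $\mathcal{M}$ the maximal ideal. The Macintyre language $\mathcal{L}_{Mac}$ consists of $\{+,-,\cdot,0,1\}$, a unary predicate $\mathcal{O}$, and unary predicates $P_n$ for all $n>1$; in $(K,v)$, $\mathcal{O}$ is interpreted as the valuation ring of $v$ and $P_n$ as the set of nonzero $n$th powers of $K$. For $r,t\in\mathcal{O}$: $r,t$ are comparable ($r\asymp t$) if there is a natural number $n\ge 1$ with $w(r^n)\le w(t)\le w(r^{n+1})$ or $w(t^n)\le w(r)\le w(t^{n+1})$; they are incomparable otherwise; $r\ll t$ (also written $t\gg r$) means $r,t$ are incomparable and $w(r)<w(t)$. For $A\subseteq L$, $\mathbb{Q}(A)$ is the subfield of $L$ generated by $A$, and for a subfield $F$ of $L$, $F^L$ denotes the algebraic closure of $F$ in $L$. A valuation ring $R$ of a field $F$ admits a henselian coarsening if there is a henselian valuation ring $R'\subsetneq F$ of $F$ with $R\subseteq R'$. $(L,w)$ is of prohenselian degree $n$ if for every $1\le m\le n$ and every $t_1,\dots,t_m\in\mathcal{M}$ with $t_m\gg\dots\gg t_1$, the valuation ring $\mathbb{Q}(t_1,\dots,t_m)^L\cap\mathcal{O}$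 of the field $\mathbb{Q}(t_1,\dots,t_m)^L$ admits a henselian coarsening. *)

(* Defs.v *)
From HB Require Import structures.
From mathcomp Require Import all_boot all_order all_algebra.
From mathcomp Require Import boolp classical_sets.

Set Implicit Arguments.
Unset Strict Implicit.
Unset Printing Implicit Defensive.

Import Order.TTheory GRing.Theory Num.Theory.

Local Open Scope classical_set_scope.
Local Open Scope ring_scope.

HB.mixin Record isOrderedGroup G of Num.POrderedZmodule G := {
  oag_le_total : forall x y : G, (x <= y) || (y <= x);
  oag_leD2l : forall z x y : G, x <= y -> z + x <= z + y
}.

#[short(type="oagType")]
HB.structure Definition OrderedGroup :=
  {G of Num.POrderedZmodule G & isOrderedGroup G}.

(* [option G] is G together with infinity, represented by [None]. *)
Section ExtendedGroup.
Variable G : oagType.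
Implicit Types a b : option G.

Definition vadd a b : option G :=
  if (a, b) is (Some x, Some y) then Some (x + y) else None.

Definition vle a b : bool :=
  match a, b with
  | _, None => true
  | None, Some _ => false
  | Some x, Some y => x <= y
  end.

Definition vlt a b : bool := ~~ vle b a.

End ExtendedGroup.

(* [val_add] is min (v x) (v y) <= v (x + y); [val_proper] makes the valuation
   ring a proper subring. *)
Record valuation (K : fieldType) (G : oagType) := Valuation {
  val_fun :> K -> option G;
  val_infty : forall x, (val_fun x == None) = (x == 0);
  val_mul : forall x y, val_fun (x * y) = vadd (val_fun x) (val_fun y);
  val_add : forall x y, vle (val_fun x) (val_fun (x + y)) ||
                        vle (val_fun y) (val_fun (x + y));
  val_proper : exists x, vlt (val_fun x) (Some 0)
}.

Section ValuationRing.
Variables (K : fieldType) (G : oagType) (v : valuation K G).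

Definition val_ring : {pred K} := [pred x | vle (Some 0) (v x)].
Definition val_max : {pred K} := [pred x | vlt (Some 0) (v x)].

Lemma vle_total (a b : option G) : vle a b || vle b a.
Proof. by case: a b => [x|] [y|] //=; apply: oag_le_total. Qed.

Lemma vle_trans (b a c : option G) : vle a b -> vle b c -> vle a c.
Proof. by case: a b c => [x|] [y|] [z|] //=; apply: le_trans. Qed.

Lemma vltW (a b : option G) : vlt a b -> vle a b.
Proof. by rewrite /vlt => /negPf nba; have := vle_total a b; rewrite nba orbF. Qed.

Lemma vle_lt_trans (b a c : option G) : vle a b -> vlt b c -> vlt a c.
Proof. by move=> ab; apply: contra => ca; apply: vle_trans ca ab. Qed.

Lemma vlt_le_trans (b a c : option G) : vlt a b -> vle b c -> vlt a c.
Proof. by move=> nba bc; apply: contra nba; apply: vle_trans. Qed.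

Lemma val_zero : v 0 = None.
Proof. by apply/eqP; rewrite val_infty. Qed.

Lemma val_one : v 1 = Some 0.
Proof.
have := val_mul v 1 1; have := val_infty v 1.
rewrite mulr1 oner_eq0; case: (v 1) => [x|] //= _ [].
by rewrite -{1}[x]addr0 => /addrI <-.
Qed.

Lemma val_opp x : v (- x) = v x.
Proof.
suff vN1 : v (-1) = Some 0.
  by rewrite -mulN1r val_mul vN1; case: (v x) => //= y; rewrite /vadd add0r.
have := val_mul v (-1) (-1); have := val_infty v (-1).
rewrite mulrNN mulr1 val_one oppr_eq0 oner_eq0.
case: (v (-1)) => [y|] //= _ [] y2; congr Some; apply: le_anti.
by case/orP: (oag_le_total y 0) => hy; have := oag_leD2l y _ _ hy;
  rewrite addr0 -y2 hy => ->.
Qed.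

Lemma val_ring_subring : GRing.subring_closed val_ring.
Proof.
split=> [|x y hx hy|x y].
- by rewrite inE val_one; apply: lexx.
- case/orP: (val_add v x (- y)) => h; first exact: vle_trans hx h.
  by rewrite val_opp in h; apply: vle_trans hy h.
- rewrite !inE val_mul; case: (v x) (v y) => [a|] [b|] //= ha hb.
  by apply: le_trans ha _; have := oag_leD2l a _ _ hb; rewrite addr0.
Qed.

HB.instance Definition _ :=
  GRing.isSubringClosed.Build K val_ring val_ring_subring.

Definition val_ring_type : predArgType := {x : K | x \in val_ring}.

HB.instance Definition _ := SubChoice.on val_ring_type.
HB.instance Definition _ :=
  [SubChoice_isSubComNzRing of val_ring_type by <:].

Definition res_ideal : {pred val_ring_type} := [pred x | val x \in val_max].

Lemma res_ideal_closed : idealr_closed res_ideal.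
Proof.
split=> [||a x y]; rewrite !inE /=.
- by rewrite val_zero.
- by rewrite val_one /vlt /= lexx.
- move=> hx hy; case/orP: (val_add v (val a * val x) (val y)) => h;
    last exact: vlt_le_trans hy h.
  apply: vlt_le_trans h; rewrite val_mul.
  have := valP a; move: hx; rewrite inE /vlt.
  case: (v (val a)) (v (val x)) => [c|] [d|] //= hd hc.
  apply: contra hd; apply: le_trans.
  by have := oag_leD2l d _ _ hc; rewrite addr0 addrC.
Qed.

HB.instance Definition _ :=
  isIdealr.Build val_ring_type res_ideal res_ideal_closed.

(* Declared as a commutative ring only: its characteristic is all that is used. *)
Definition residue_field : comNzRingType := {ideal_quot res_ideal}.

End ValuationRing.

Arguments res_ideal {K G} v _.

Section Henselian.
Variable L : fieldType.
Implicit Types (A E R : set L).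

Definition gen_field A : set L :=
  [set x | forall E, GRing.divring_closed [in E] -> A `<=` E -> E x].

Definition alg_closure_in E : set L :=
  [set x | exists p : {poly L}, [/\ p \is a polyOver [in E], p != 0 & root p x]].

Definition is_val_ring E R : Prop :=
  [/\ R `<` E, GRing.subring_closed [in R] &
      forall x, E x -> x != 0 -> R x \/ R x^-1].

(* The nonunits of R; [x != 0] is needed because 0^-1 = 0. *)
Definition max_ideal R : set L := [set x | R x /\ ~ (x != 0 /\ R x^-1)].

(* Hensel's lemma: simple zeros of the reduction of f lift to R. *)
Definition henselian_ring R : Prop :=
  forall (f : {poly L}) (a : L),
    f \is a polyOver [in R] -> R a ->
    max_ideal R f.[a] -> ~ max_ideal R f^`().[a] ->
  exists b, [/\ R b, f.[b] = 0 & max_ideal R (b - a)].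

Definition admits_henselian_coarsening E R : Prop :=
  exists R', [/\ is_val_ring E R', henselian_ring R' & R `<=` R'].

End Henselian.

Section Prohenselian.
Variables (L : fieldType) (G : oagType) (w : valuation L G).

Definition henselian : Prop := henselian_ring [set` val_ring w].

Definition comparable (r t : L) : Prop :=
  exists2 n : nat, (0 < n)%N &
    (vle (w (r ^+ n)) (w t) && vle (w t) (w (r ^+ n.+1))) ||
    (vle (w (t ^+ n)) (w r) && vle (w r) (w (t ^+ n.+1))).

Definition vll (r t : L) : Prop := ~ comparable r t /\ vlt (w r) (w t).

(* The t_i are nonzero: adjoining 0 adds nothing to the field, and for t_1 = 0
   in residue characteristic 0 the ring in question would be a whole field,
   which is not a valuation ring here. *)
Definition prohenselian (n : nat) : Prop :=
  forall m, (1 <= m <= n)%N ->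
  forall t : 'I_m -> L,
    (forall i, t i \in val_max w /\ t i != 0) ->
    (forall i j : 'I_m, j = i.+1 :> nat -> vll (t i) (t j)) ->
  let E := alg_closure_in (gen_field (range t)) in
  admits_henselian_coarsening E (E `&` [set` val_ring w]).

End Prohenselian.

Inductive mac_term : Type :=
  | TVar of nat
  | TZero
  | TOne
  | TAdd of mac_term & mac_term
  | TOpp of mac_term
  | TMul of mac_term & mac_term.

(* [FPow k t] is P_n(t) with n = k.+2, so that n ranges over all n > 1. *)
Inductive mac_formula : Type :=
  | FEq of mac_term & mac_term
  | FVal of mac_term
  | FPow of nat & mac_term
  | FFalse
  | FNot of mac_formula
  | FAnd of mac_formula & mac_formula
  | FOr of mac_formula & mac_formula
  | FImp of mac_formula & mac_formula
  | FForall of nat & mac_formula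
  | FExists of nat & mac_formula.

Fixpoint term_vars (t : mac_term) : seq nat :=
  match t with
  | TVar i => [:: i]
  | TZero | TOne => [::]
  | TAdd t1 t2 | TMul t1 t2 => term_vars t1 ++ term_vars t2
  | TOpp t1 => term_vars t1
  end.

Fixpoint free_vars (f : mac_formula) : seq nat :=
  match f with
  | FEq t1 t2 => term_vars t1 ++ term_vars t2
  | FVal t | FPow _ t => term_vars t
  | FFalse => [::]
  | FNot f1 => free_vars f1
  | FAnd f1 f2 | FOr f1 f2 | FImp f1 f2 => free_vars f1 ++ free_vars f2
  | FForall i f1 | FExists i f1 => [seq j <- free_vars f1 | j != i]
  end.

Definition is_sentence (f : mac_formula) : bool := nilp (free_vars f).

Fixpoint quantifier_free (f : mac_formula) : bool :=
  match f with
  | FEq _ _ | FVal _ | FPow _ _ | FFalse => true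
  | FNot f1 => quantifier_free f1
  | FAnd f1 f2 | FOr f1 f2 | FImp f1 f2 =>
      quantifier_free f1 && quantifier_free f2
  | FForall _ _ | FExists _ _ => false
  end.

(* [ms_pow k] interprets P_(k.+2). *)
Record mac_structure := MacStructure {
  ms_sort :> Type;
  ms_zero : ms_sort;
  ms_one : ms_sort;
  ms_add : ms_sort -> ms_sort -> ms_sort;
  ms_opp : ms_sort -> ms_sort;
  ms_mul : ms_sort -> ms_sort -> ms_sort;
  ms_val : ms_sort -> Prop;
  ms_pow : nat -> ms_sort -> Prop
}.

Section Semantics.
Variable M : mac_structure.
Implicit Type e : nat -> M.

Definition update e (i : nat) (a : M) : nat -> M :=
  fun j => if j == i then a else e j.

Fixpoint eval_term e (t : mac_term) : M :=
  match t with
  | TVar i => e i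
  | TZero => ms_zero M
  | TOne => ms_one M
  | TAdd t1 t2 => ms_add (eval_term e t1) (eval_term e t2)
  | TOpp t1 => ms_opp (eval_term e t1)
  | TMul t1 t2 => ms_mul (eval_term e t1) (eval_term e t2)
  end.

Fixpoint satisfies e (f : mac_formula) : Prop :=
  match f with
  | FEq t1 t2 => eval_term e t1 = eval_term e t2
  | FVal t => ms_val (eval_term e t)
  | FPow k t => ms_pow k (eval_term e t)
  | FFalse => False
  | FNot f1 => ~ satisfies e f1
  | FAnd f1 f2 => satisfies e f1 /\ satisfies e f2
  | FOr f1 f2 => satisfies e f1 \/ satisfies e f2
  | FImp f1 f2 => satisfies e f1 -> satisfies e f2
  | FForall i f1 => forall a, satisfies (update e i a) f1
  | FExists i f1 => exists a, satisfies (update e i a) f1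
  end.

Definition theory : set mac_formula :=
  [set f | is_sentence f /\ forall e, satisfies e f].

Definition is_model (T : set mac_formula) : Prop :=
  forall f, T f -> forall e, satisfies e f.

End Semantics.

(* Provable equivalence from T is expressed semantically, by Goedel completeness. *)
Definition admits_qe (T : set mac_formula) : Prop :=
  forall f, exists g,
    [/\ quantifier_free g, {subset free_vars g <= free_vars f} &
        forall M : mac_structure, is_model M T ->
        forall e : nat -> M, satisfies e f <-> satisfies e g].

Definition mac_of_valued_field (K : fieldType) (G : oagType)
    (v : valuation K G) : mac_structure :=
  @MacStructure K 0 1 +%R -%R *%R
    (fun x => x \in val_ring v)
    (fun k x => x != 0 /\ exists y : K, x = y ^+ k.+2).

(* Main.v *)
From HB Require Import structures.
From Stdlib Require List.
Require Import Defs.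
From mathcomp Require Import all_boot all_order all_algebra all_field.
From mathcomp Require Import boolp classical_sets.
From mathcomp Require Import ring.

Set Implicit Arguments.
Unset Strict Implicit.
Unset Printing Implicit Defensive.

Import Order.TTheory GRing.Theory Num.Theory.

Local Open Scope ring_scope.

(** For [t] in the maximal ideal M, the field Q(t)^K carries a valuation ring of rank one,
    so that it is its own henselian coarsening and 1 + M consists of [k]-th powers for all
    [k]. Hence a quantifier-free formula of the Macintyre language keeps its truth value
    under a perturbation of its variables which is small compared to the polynomials
    occurring in it, as long as those which are not identically zero do not vanish.

    Suppose Hensel's lemma fails for [f] on the residue disc [a] + M. By Newton's
    iteration the values of [f] on the disc generate a convex subgroup H; let F be the
    residue field of the coarsening of [v] by H. Over F, the reduction of [f] takes
    arbitrarily small values on the disc but has no root there, and so does one of its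
    irreducible factors [g], of degree k > 1. By quantifier elimination, the existence of
    a root of X^k + a_(k-1) X^(k-1) + ... + a_0 is expressed by a quantifier-free formula in
    the a_i. Replacing a root of [g] by another generator of the field it generates over F, the
    coefficients of [g] can be moved away from any given hypersurface over the integers.
    Lifted to K, this polynomial has no root, but has a root after an arbitrarily small
    (relative to H) change of its constant coefficient, which the formula does not notice. *)

(** * Terms as polynomial functions *)

(** Values are taken in any commutative ring, so that terms can be moved along ring morphisms and
    evaluated at polynomials. *)
Fixpoint teval (R : comNzRingType) (e : nat -> R) (t : mac_term) : R :=
  match t with
  | TVar i => e i
  | TZero => 0
  | TOne => 1
  | TAdd t1 t2 => teval e t1 + teval e t2
  | TOpp t1 => - teval e t1
  | TMul t1 t2 => teval e t1 * teval e t2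
  end.

Lemma teval_rmorph (R S : comNzRingType) (h : {rmorphism R -> S}) (e : nat -> R) t :
  h (teval e t) = teval (h \o e) t.
Proof.
elim: t => //= [||t1 IH1 t2 IH2|t IH|t1 IH1 t2 IH2].
- exact: rmorph0.
- exact: rmorph1.
- by rewrite rmorphD IH1 IH2.
- by rewrite rmorphN IH.
- by rewrite rmorphM IH1 IH2.
Qed.

(** In characteristic 0 the first [size p] positive integers are distinct, too many to be roots of
    [p]. *)
Lemma nat_nonroot (F : fieldType) (p : {poly F}) :
  (forall n, n.+1%:R != 0 :> F) -> p != 0 -> exists n : nat, p.[n.+1%:R] != 0.
Proof.
move=> char0 p0; apply/not_existsP => nr.
pose rs : seq F := [seq (nat_of_ord i).+1%:R | i <- enum 'I_(size p)].
have inj : injective (fun i : nat => i.+1%:R : F).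
  suff lt_inj i j : (i < j)%N -> i.+1%:R != j.+1%:R :> F.
    move=> i j /eqP ij; case: (ltngtP i j) => // lt; move: (lt_inj _ _ lt).
      by rewrite ij.
    by rewrite eq_sym ij.
  move=> ij; have -> : j.+1 = (i.+1 + (j - i).-1.+1)%N.
    by rewrite prednK ?subn_gt0// addSn subnKC// ltnW.
  by rewrite natrD eq_sym -subr_eq0 addrAC subrr add0r char0.
have := @max_poly_roots _ p rs p0.
rewrite size_map size_enum_ord ltnn => H; suff: false by []; apply: H.
  apply/allP => _ /mapP[i _ ->]; rewrite /root; apply/negP => /negP.
  exact: nr.
rewrite map_inj_uniq ?enum_uniq// => i j /inj; exact: val_inj.
Qed.

Section SeparatelyPolynomial.
Variable F : fieldType.
Hypothesis char0 : forall n, n.+1%:R != 0 :> F.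
Implicit Types (e : nat -> F) (G : (nat -> F) -> F).

Definition upd e i s : nat -> F := fun j => if j == i then s else e j.

(** Being polynomial in each variable separately is enough to replace the variables one at a time by
    positive integers, and is easy to check for coefficients of characteristic polynomials. *)
Definition seppoly G := forall e i, exists p : {poly F}, forall s, G (upd e i s) = p.[s].

Lemma seppoly_nat G e d : seppoly G -> G e != 0 ->
  exists x : nat -> nat, G (fun i => if (i < d)%N then (x i).+1%:R else e i) != 0.
Proof.
move=> sG Ge; elim: d => [|d [x Gx]]; first by exists (fun=> 0).
set e' := (fun i => _) in Gx; have [p Gp] := sG e' d.
have p0 : p != 0.
  apply: contraNneq Gx => p0; have := Gp (e' d); rewrite p0 horner0 => Gn.
  by apply/eqP; rewrite -[RHS]Gn; congr G; apply: funext => i; rewrite /upd; case: eqP => [->|].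
have [m pm] := nat_nonroot char0 p0; rewrite -Gp in pm.
exists (fun i => if i == d then m else x i); apply: contraNneq pm => Gn.
apply/eqP; rewrite -[RHS]Gn; congr G; apply: funext => i; rewrite /upd /e'.
by rewrite [in RHS]ltnS [in RHS]leq_eqVlt; case: eqP.
Qed.

Lemma seppoly_teval (c : (nat -> F) -> nat -> F) t :
  (forall j, seppoly (c^~ j)) -> seppoly (fun e => teval (c e) t).
Proof.
move=> cP e i; elim: t => /= [j|||t1 [p1 h1] t2 [p2 h2]|t1 [p1 h1]|t1 [p1 h1] t2 [p2 h2]].
- exact: cP.
- by exists 0 => s; rewrite horner0.
- by exists 1 => s; rewrite hornerC.
- by exists (p1 + p2) => s; rewrite hornerD h1 h2.
- by exists (- p1) => s; rewrite hornerN h1.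
- by exists (p1 * p2) => s; rewrite hornerM h1 h2.
Qed.

(** The characteristic polynomial of A + X B over F[X] specialises at X = s. *)
Lemma seppoly_char_poly n (A B : 'M[F]_n) j :
  exists p : {poly F}, forall s, (char_poly (A + s *: B))`_j = p.[s].
Proof.
exists (char_poly (map_mx polyC A + 'X *: map_mx polyC B))`_j => s.
rewrite -[RHS]/(horner_eval s _) -coef_map map_char_poly; congr ((char_poly _)`_j).
by apply/matrixP => a b; rewrite !mxE /= /horner_eval !hornerE.
Qed.

End SeparatelyPolynomial.

(** * Terms which do not vanish identically on integer tuples *)

(* Tuples of length d are encoded as coefficient sequences of polynomials of size at most d. *)
Definition nonzero_term d t :=
  exists2 q : {poly int}, (size q <= d)%N & teval (nth 0 q) t != 0.

Lemma intr_neq0 (F : fieldType) : (forall n, n.+1%:R != 0 :> F) ->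
  forall m : int, m != 0 -> m%:~R != 0 :> F.
Proof.
move=> char0 [[|m]|m] //= _; first exact: char0.
by rewrite NegzE rmorphN oppr_eq0 char0.
Qed.

(** Were the value nonzero, the coefficients of [q] could be replaced by positive integers without
    making it vanish, and that value is the image of an integer. *)
Lemma zero_term (F : fieldType) d t (q : {poly F}) :
  (forall n, n.+1%:R != 0 :> F) -> ~ nonzero_term d t -> (size q <= d)%N ->
  teval (nth 0 q) t = 0.
Proof.
move=> char0 nz sq; apply: contrapT => /eqP tq; apply: nz.
have sp : seppoly (fun e : nat -> F => teval e t).
  apply: seppoly_teval => j e i; rewrite /upd; case: eqP => _.
    by exists 'X => s; rewrite hornerX.
  by exists (e j)%:P => s; rewrite hornerC.
have [x tx] := seppoly_nat char0 d sp tq.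
exists (\poly_(i < d) (x i).+1%:Z); first exact: size_poly.
apply: contraNneq tx => /(congr1 (fun z : int => z%:~R : F)).
rewrite teval_rmorph rmorph0 => tx; apply/eqP; rewrite -[RHS]tx.
congr teval; apply: funext => i /=; rewrite coef_poly; case: ifP => // id.
by rewrite nth_default// (leq_trans sq)// leqNgt id.
Qed.

Definition tprod : seq mac_term -> mac_term := foldr TMul TOne.

Lemma tprod_neq0 (F : fieldType) (e : nat -> F) ts :
  teval e (tprod ts) != 0 -> forall t, List.In t ts -> teval e t != 0.
Proof.
elim: ts => //= t ts IH; rewrite mulf_eq0 negb_or => /andP[t0 ts0] t' [<-|] //.
exact: IH.
Qed.

Lemma teval_line (F : comNzRingType) (q r : {poly F}) t s :
  teval (nth 0 (q + s *: r)) t = (teval (fun i => (q`_i)%:P + (r`_i)%:P * 'X) t).[s].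
Proof.
rewrite -[RHS]/(horner_eval s _) teval_rmorph; congr teval; apply: funext => i /=.
by rewrite /horner_eval coefD coefZ !hornerE mulrC.
Qed.

(** On the line joining a witness for the first term to one for the others, both restrictions are
    nonzero polynomials over the rationals. Some positive integer is a root of neither, and the
    point with this parameter is still integral. *)
Lemma nonzero_tprod d ts :
  (forall t, List.In t ts -> nonzero_term d t) -> nonzero_term d (tprod ts).
Proof.
elim: ts => /= [_|t ts IH H]; first by exists 0 => /=; rewrite ?size_poly0 ?oner_eq0.
have [q sq tq] := H t (or_introl erefl).
have [|r sr tr] := IH; first by move=> t' ?; apply: H; right.
pose q' : {poly rat} := map_poly intr q; pose r' : {poly rat} := map_poly intr (r - q).
pose L t := teval (fun i => (q'`_i)%:P + (r'`_i)%:P * 'X) t.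
have LE t' s : (L t').[s] = teval (nth 0 (q' + s *: r')) t' by rewrite teval_line.
have tE (p : {poly int}) t' : teval (nth 0 (map_poly intr p : {poly rat})) t' =
    (teval (nth 0 p) t')%:~R.
  by rewrite teval_rmorph; congr teval; apply: funext => i /=; rewrite coef_map.
have L0 : L t != 0.
  apply: contraNneq tq => L0; rewrite -(intr_eq0 rat) -tE.
  by have := LE t 0; rewrite L0 horner0 scale0r addr0 => <-.
have L1 : L (tprod ts) != 0.
  apply: contraNneq tr => L1; rewrite -(intr_eq0 rat) -tE.
  by have := LE (tprod ts) 1; rewrite L1 horner0 scale1r -rmorphD addrC subrK => <-.
have [n] : exists n : nat, (L t * L (tprod ts)).[n.+1%:R] != 0.
  by apply: nat_nonroot; rewrite ?mulf_neq0// => n; rewrite pnatr_eq0.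
rewrite hornerM mulf_eq0 negb_or !LE => /andP[n1 n2].
have qrE : q' + n.+1%:R *: r' = map_poly intr (q + n.+1%:Z *: (r - q)).
  by rewrite rmorphD /= map_polyZ.
exists (q + n.+1%:Z *: (r - q)).
  apply: (leq_trans (size_polyD _ _)); rewrite geq_max sq.
  apply: (leq_trans (size_scale_leq _ _)); apply: (leq_trans (size_polyD _ _)).
  by rewrite size_polyN geq_max sr sq.
by rewrite /= mulf_neq0// -(intr_eq0 rat) -tE -qrE.
Qed.

(** * Splitting fields *)

Lemma split_extension (F : fieldType) (p : {poly F}) : p != 0 ->
  exists (L : fieldType) (h : {rmorphism F -> L}) (rs : seq L),
    map_poly h p %= \prod_(r <- rs) ('X - r%:P).
Proof.
have [n] := ubnP (size p); elim: n F p => // n IH F p; rewrite ltnS => sp p0.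
have [p1|p1] := leqP (size p) 1.
  exists F, idfun, [::]; rewrite big_nil map_poly_id//.
  by rewrite -size_poly_eq1 eqn_leq p1 size_poly_gt0 p0.
suff [L [h [z rz]]] : exists (L : fieldType) (h : {rmorphism F -> L}) z, root (map_poly h p) z.
  have /factor_theorem[q pq] := rz.
  have q0 : q != 0.
    by apply: contraNneq p0 => q0; rewrite -(map_poly_eq0 h) pq q0 mul0r.
  have sq : (size q < n)%N.
    apply: leq_trans sp; rewrite -(size_map_poly h p) pq.
    by rewrite size_Mmonic ?monicXsubC// size_XsubC addn2.
  have [M [h' [rs qrs]]] := IH L q sq q0.
  exists M, (h' \o h), (h' z :: rs).
  rewrite big_cons map_poly_comp pq rmorphM /= rmorphB /= map_polyX map_polyC mulrC.
  by apply: eqp_mull.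
have [r [rirr rp]] : exists r : {poly F}, irreducible_poly r /\ r %| p.
  have [m] := ubnP (size p); elim: m {n IH sp p0} p p1 => // m IH p p1 sp.
  have [irr|] := pselect (irreducible_poly p); first by exists p.
  have p0 : p != 0 by apply: contraTneq p1 => ->; rewrite size_poly0.
  move=> nirr; have [q [q1 qp qnp]] :
      exists q : {poly F}, [/\ size q != 1%N, q %| p & ~~ (q %= p)].
    apply: contrapT => H; apply: nirr; split=> // q q1 qp; apply/negPn/negP => nq.
    by apply: H; exists q.
  have q0 : q != 0 by apply: contraTneq qp => ->; rewrite dvd0p.
  have sq1 : (1 < size q)%N.
    by move: q1 q0; rewrite -size_poly_gt0; case: (size q) => [|[]].
  have sqp : (size q < size p)%N.
    by rewrite ltn_neqAle dvdp_leq// andbT dvdp_size_eqp.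
  have [|r [rirr rq]] := IH q sq1; first by rewrite -ltnS (leq_trans _ sp) ?ltnS.
  by exists r; split=> //; apply: dvdp_trans qp.
have [L _ [z rz _]] := irredp_FAdjoin rirr.
exists L, (in_alg L), z; apply: root_dvdp rz.
by rewrite dvdp_map.
Qed.

(** * Perturbing irreducible polynomials *)

(** The dimension is a successor fixed in advance, as suits [horner_mx], instead of being computed
    from [p]. *)
Definition companion (R : nzRingType) n (p : {poly R}) : 'M[R]_n.+1 :=
  \matrix_(i, j) if i == n :> nat then - p`_j else (i.+1 == j :> nat)%:R.

Lemma char_poly_companion (R : comNzRingType) n (p : {poly R}) :
  p \is monic -> size p = n.+2 -> char_poly (companion n p) = p.
Proof.
move=> pm sp; rewrite -[RHS](companionmxK pm).
have e : (size p).-1 = n.+1 by rewrite sp.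
rewrite /companionmx; move: e; move: (size p).-1 => d e.
by subst d.
Qed.

Lemma det_Vandermonde_neq0 (F : fieldType) n (a : 'rV[F]_n) :
  injective (a 0) -> \det (Vandermonde n a) != 0.
Proof.
move=> inja; rewrite det_Vandermonde prodf_seq_neq0; apply/allP => i _ /=.
rewrite prodf_seq_neq0; apply/allP => j _; apply/implyP => ij.
by rewrite subr_eq0; apply: contraTneq ij => /inja ->; rewrite ltnn.
Qed.

(** The column of powers of a root is an eigenvector of the companion matrix for that root. *)
Lemma companion_Vandermonde (F : fieldType) n (p : {poly F}) (a : 'rV[F]_n.+1) :
  p \is monic -> size p = n.+2 -> (forall i, root p (a 0 i)) ->
  companion n p *m Vandermonde n.+1 a = Vandermonde n.+1 a *m diag_mx a.
Proof.
move=> pm sp ra; apply/matrixP => i j; rewrite mul_mx_diag !mxE.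
have [ni|ni] := eqVneq (i : nat) n.
  under eq_bigr do rewrite !mxE ni eqxx mulNr.
  rewrite sumrN ni -exprSr; apply/eqP; rewrite eq_sym -subr_eq0 opprK addrC.
  have := ra j; rewrite /root horner_coef sp big_ord_recr /=.
  by move: pm; rewrite monicE lead_coefE sp /= => /eqP ->; rewrite mul1r.
have lt : (i.+1 < n.+1)%N by rewrite ltn_neqAle eqSS ni ltn_ord.
rewrite (bigD1 (Ordinal lt)) //= big1 => [|k kn]; last first.
  rewrite !mxE (negPf ni); case: eqP => [ik|_]; last by rewrite mul0r.
  by rewrite -val_eqE /= ik eqxx in kn.
by rewrite !mxE (negPf ni) eqxx mul1r addr0 exprSr.
Qed.

Lemma horner_mx_intertwine (F : fieldType) n (A B V : 'M[F]_n.+1) q :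
  A *m V = V *m B -> horner_mx A q *m V = V *m horner_mx B q.
Proof.
move=> AV; elim/poly_ind: q => [|q c IH]; first by rewrite !rmorph0 mul0mx mulmx0.
rewrite !rmorphD !rmorphM /= !horner_mx_X !horner_mx_C mulmxDl mulmxDr.
rewrite scalar_mxC; congr (_ + _).
by rewrite -!mulmxE -mulmxA AV mulmxA IH mulmxA.
Qed.

Lemma horner_mx_comp (R : comNzRingType) n (A : 'M[R]_n.+1) p q :
  horner_mx A (p \Po q) = horner_mx (horner_mx A q) p.
Proof.
elim/poly_ind: p => [|p c IH]; first by rewrite comp_poly0 !rmorph0.
rewrite comp_poly_MXaddC !rmorphD !rmorphM /= IH horner_mx_X.
by rewrite !horner_mx_C.
Qed.

Lemma char_poly_intertwine (F : fieldType) n (A B V : 'M[F]_n) :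
  \det V != 0 -> A *m V = V *m B -> char_poly A = char_poly B.
Proof.
move=> ring_pred0 AV; apply: (mulIf (_ : \det (map_mx polyC V) != 0)).
  by rewrite det_map_mx polyC_eq0.
rewrite -det_mulmx [RHS]mulrC -det_mulmx /char_poly_mx mulmxBl mulmxBr.
by rewrite scalar_mxC -!map_mxM AV.
Qed.

(** The Vandermonde matrix of the roots diagonalises the companion matrix, and with it every
    polynomial in this matrix. *)
Lemma char_poly_horner_companion (F : fieldType) n (p q : {poly F}) (a : 'rV[F]_n.+1) :
  p \is monic -> size p = n.+2 -> injective (a 0) -> (forall i, root p (a 0 i)) ->
  char_poly (horner_mx (companion n p) q) = \prod_i ('X - (q.[a 0 i])%:P).
Proof.
move=> pm sp inja ra; rewrite (@char_poly_intertwine _ _ _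
   (horner_mx (diag_mx a) q) _ (det_Vandermonde_neq0 inja)); last first.
  exact/horner_mx_intertwine/companion_Vandermonde.
rewrite horner_mx_diag char_poly_trig ?diag_mx_is_trig//.
by apply: eq_bigr => i _; rewrite !mxE eqxx.
Qed.

(** The coefficients solve a linear system with a Vandermonde matrix, invertible since the nodes are
    distinct. *)
Lemma interpolate (F : fieldType) n (a : 'rV[F]_n.+1) (r : 'I_n.+1 -> F) :
  injective (a 0) -> exists2 q : {poly F}, (size q <= n.+1)%N & forall i, q.[a 0 i] = r i.
Proof.
move=> inja; have Vu : Vandermonde n.+1 a \in unitmx.
  by rewrite unitmxE unitfE det_Vandermonde_neq0.
pose u := (\row_i r i) *m invmx (Vandermonde n.+1 a).
exists (rVpoly u); first exact: size_poly.
move=> i; have : (u *m Vandermonde n.+1 a) 0 i = r i by rewrite mulmxKV// mxE.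
rewrite mxE => <-; rewrite (@horner_coef_wide _ n.+1) ?size_poly//.
by apply: eq_bigr => j _; rewrite coef_rVpoly_ord !mxE.
Qed.

Lemma eqp_monic_prod (F : fieldType) (p : {poly F}) (rs : seq F) :
  p \is monic -> p %= \prod_(r <- rs) ('X - r%:P) -> p = \prod_(r <- rs) ('X - r%:P).
Proof. by move=> pm; rewrite eqp_monic// ?monic_prod_XsubC// => /eqP. Qed.

Lemma split_factor (F : fieldType) (p : {poly F}) (rs : seq F) :
  p \is monic -> p %| \prod_(r <- rs) ('X - r%:P) ->
  exists ss : seq F, p = \prod_(r <- ss) ('X - r%:P).
Proof.
move=> pm /dvdp_prod_XsubC[m /eqp_monic_prod pE].
by exists (mask m rs); apply: pE.
Qed.

(** In characteristic 0 the derivative of [p] is nonzero and of smaller degree, hence coprime to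
    [p]: the roots are simple. *)
Lemma irreducible_split_uniq (F L : fieldType) (h : {rmorphism F -> L}) (p : {poly F}) ss :
  (forall n, n.+1%:R != 0 :> F) -> irreducible_poly p ->
  map_poly h p = \prod_(r <- ss) ('X - r%:P) -> uniq ss.
Proof.
move=> char0 pirr pE; rewrite -separable_prod_XsubC -pE separable_map.
rewrite unlock irreducible_poly_coprime//; apply/negP => /dvdp_leq.
have sp := pirr.1.
have sp' : (size p).-1 = (size p).-2.+1 by case: (size p) sp => [|[]].
have p'0 : p^`() != 0.
  apply/eqP => /(congr1 (fun q : {poly F} => q`_(size p).-2)) /eqP.
  rewrite coef_deriv coef0 -sp' -mulr_natr mulf_eq0 -lead_coefE lead_coef_eq0.
  by rewrite sp' (negPf (char0 _)) orbF -size_poly_eq0 -leqn0 leqNgt ltnW.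
by move=> /(_ p'0); rewrite leqNgt lt_size_deriv// -size_poly_gt0 ltnW.
Qed.

(* Over a splitting field of [g], interpolation yields a polynomial in the companion
   matrix of [g] with prescribed split characteristic polynomial; a polynomial
   function that does not vanish there does not vanish at some natural tuple. *)
Lemma irreducible_perturb (F : fieldType) (g : {poly F}) n t :
  (forall n, n.+1%:R != 0 :> F) -> irreducible_poly g -> g \is monic -> size g = n.+3 ->
  nonzero_term n.+2 t ->
  exists (gs : {poly F}) (x : nat -> nat), let gam := \poly_(i < n.+2) (x i)%:R in
   [/\ gs \is monic /\ size gs = n.+3, forall z, ~~ root gs z, g %| gs \Po gam &
    teval (nth 0 (gs - 'X^(n.+2) : {poly F})) t != 0].
Proof.
move=> char0 girr gm sg [q0 sq0 tq0].
(* When [p] has distinct roots, the roots of [cp R p q] are the values of [q] at them. *)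
pose cp (R : fieldType) (p q : {poly R}) : {poly R} := char_poly (horner_mx (companion n.+1 p) q).
have cp_monic (R : fieldType) (p q : {poly R}) : cp R p q \is monic by apply: char_poly_monic.
pose c (R : fieldType) (p : {poly R}) (e : nat -> R) j :=
  (cp R p (\poly_(i < n.+2) e i) - 'X^(n.+2))`_j.
suff [x tx] : exists x : nat -> nat, teval (c F g (fun i => (x i).+1%:R)) t != 0.
  pose gam : {poly F} := \poly_(i < n.+2) (x i).+1%:R.
  have CHg : horner_mx (companion n.+1 g) g = 0.
    by rewrite -{2}(char_poly_companion gm sg) Cayley_Hamilton.
  exists (cp F g gam), (fun i => (x i).+1); rewrite /= -/gam; split => //.
  - split; [exact: cp_monic|exact: size_char_poly].
  (* The polynomial [gam] - z is nonzero, as its coefficient of X is a positive integer, and has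
     smaller degree than [g]. So it is coprime to [g], hence invertible at the companion matrix, and
     z is no eigenvalue. *)
  - move=> z; rewrite -eigenvalue_root_char; apply/negP => /eigenvalueP[v vz v0].
    have gz : gam - z%:P != 0.
      apply/eqP => /(congr1 (fun q : {poly F} => q`_1)) /eqP.
      by rewrite coefB coefC subr0 coef_poly coef0 /= (negPf (char0 _)).
    have : coprimep g (gam - z%:P).
      rewrite irreducible_poly_coprime//; apply/negP => /(dvdp_leq gz).
      rewrite sg leqNgt => /negP; apply; rewrite ltnS; apply: (leq_trans (size_polyD _ _)).
      by rewrite geq_max size_poly size_polyN size_polyC (leq_trans (leq_b1 _)).
    case/Bezout_eq1_coprimepP => -[u w] /= uw.
    have := congr1 (horner_mx (companion n.+1 g)) uw.
    rewrite rmorphD !rmorphM rmorphB /= CHg mulr0 add0r horner_mx_C rmorph1 => H.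
    have : v *m ((horner_mx (companion n.+1 g) gam - z%:M) *m
                  horner_mx (companion n.+1 g) w) = v.
      by rewrite (mulmx1C H) mulmx1.
    by rewrite mulmxA mulmxBr vz mul_mx_scalar subrr mul0mx => v00; rewrite -v00 eqxx in v0.
  (* The irreducible [g] annihilates the companion matrix, so it is associated to the minimal
     polynomial, which divides everything that annihilates this matrix. *)
  - suff : mxminpoly (companion n.+1 g) %| cp F g gam \Po gam.
      apply: dvdp_trans; have : mxminpoly (companion n.+1 g) %| g.
        by rewrite dvd_mxminpoly CHg.
      move/(girr.2 _); rewrite size_mxminpoly => H; suff: mxminpoly (companion n.+1 g) %= g.
        by rewrite /eqp => /andP[].
      by apply: H; rewrite eqSS -lt0n mxminpoly_nonconstant.
    by rewrite dvd_mxminpoly horner_mx_comp Cayley_Hamilton.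
(* The target polynomial: its lower coefficients are the integers at which [t] does not vanish. *)
pose h : {poly F} := 'X^(n.+2) + map_poly intr q0.
have sq0F : (size (map_poly intr q0 : {poly F}) < n.+3)%N.
  by rewrite ltnS; apply: leq_trans sq0; apply: size_poly.
have sh : size h = n.+3 by rewrite /h size_polyDl size_polyXn.
have hm : h \is monic by rewrite monicE lead_coefDl ?size_polyXn// lead_coefXn.
have [L [io [rs ghE]]] : exists (L : fieldType) (io : {rmorphism F -> L}) (rs : seq L),
    map_poly io (g * h) %= \prod_(r <- rs) ('X - r%:P).
  by apply: split_extension; rewrite mulf_neq0// monic_neq0.
have := eqp_monic_prod _ ghE; rewrite map_monic monicMr// => /(_ gm) {}ghE.
have [ag gE] : exists ss, map_poly io g = \prod_(r <- ss) ('X - r%:P).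
  by apply: (@split_factor _ _ rs); rewrite ?map_monic// -ghE rmorphM dvdp_mulr.
have [rh hE] : exists ss, map_poly io h = \prod_(r <- ss) ('X - r%:P).
  by apply: (@split_factor _ _ rs); rewrite ?map_monic// -ghE rmorphM dvdp_mull.
have sag : size ag = n.+2.
  by apply/eqP; rewrite -eqSS -(size_prod_XsubC _ id) -gE size_map_poly sg.
have srh : size rh = n.+2.
  by apply/eqP; rewrite -eqSS -(size_prod_XsubC _ id) -hE size_map_poly sh.
pose a : 'rV[L]_n.+2 := \row_i ag`_i.
have inja : injective (a 0).
  move=> i j; rewrite !mxE => /eqP; rewrite nth_uniq ?sag//; first by move/eqP/val_inj.
  exact: irreducible_split_uniq gE.
(* Sending the roots of [g] to those of [h] turns the characteristic polynomial into [h]. *)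
have [q sq qa] := interpolate (fun i => rh`_i) inja.
have cpE : cp L (map_poly io g) q = map_poly io h.
  rewrite /cp (@char_poly_horner_companion _ _ _ _ a)//; first last.
  - by move=> i; rewrite gE root_prod_XsubC mxE mem_nth// sag.
  - by rewrite size_map_poly.
  - by rewrite map_monic.
  rewrite hE [in RHS](big_nth 0) srh big_mkord.
  by apply: eq_bigr => i _; rewrite qa.
have char0L k : k.+1%:R != 0 :> L by rewrite -(rmorph_nat io) fmorph_eq0.
have tq : teval (c L (map_poly io g) (nth 0 q)) t != 0.
  apply: contraTneq tq0 => tq; have := intr_neq0 char0L; rewrite negbK => H.
  apply: contraTT isT => /H; rewrite teval_rmorph -[X in _ != X]tq => /eqP; case.
  congr teval; apply: funext => j; rewrite /= /c.
  have -> : \poly_(i < n.+2) q`_i = q by apply/polyP => i; rewrite coef_poly; case: ltnP => // iq; rewrite nth_default// (leq_trans sq).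
  by rewrite cpE /h rmorphD /= map_polyXn addrC addKr coef_map /= coef_map /= rmorph_int.
(* Varying one coefficient of the polynomial moves its value at the companion matrix along a line of
   matrices. *)
have sp : seppoly (fun e => teval (c L (map_poly io g) e) t).
  apply: seppoly_teval => j e i; rewrite /c /cp.
  pose d : {poly L} := if (i < n.+2)%N then 'X^i else 0.
  have uE s : \poly_(k < n.+2) upd e i s k = \poly_(k < n.+2) upd e i 0 k + s *: d.
    apply/polyP => k; rewrite coefD coefZ !coef_poly /upd /d.
    case: (ltnP k n.+2) => [kn|kn].
      case: (k =P i) => [ki|/eqP ki]; first by rewrite -ki kn coefXn eqxx mulr1 add0r.
      by case: ifP => _; rewrite ?coefXn ?(negPf ki) ?coef0 mulr0 addr0.
    case: ltnP => ik; rewrite ?coef0 ?mulr0 ?addr0// coefXn gtn_eqF ?mulr0 ?addr0//.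
    exact: leq_trans kn.
  have [p pE] := seppoly_char_poly (horner_mx (companion n.+1 (map_poly io g))
     (\poly_(k < n.+2) upd e i 0 k)) (horner_mx (companion n.+1 (map_poly io g)) d) j.
  exists (p - (('X^(n.+2) : {poly L})`_j)%:P) => s.
  by rewrite coefB uE rmorphD /= horner_mxZ pE !hornerE.
have [x tx] := seppoly_nat char0L n.+2 sp tq.
exists x; rewrite -(fmorph_eq0 io) teval_rmorph; apply: contraNneq tx => tx.
apply/eqP; rewrite -[RHS]tx; congr teval; apply: funext => j /=.
rewrite /c -coef_map rmorphB /= map_polyXn /cp map_char_poly map_horner_mx.
have -> : map_mx io (companion n.+1 g) = companion n.+1 (map_poly io g).
  apply/matrixP => i k; rewrite !mxE /=; case: eqP => _; last exact: rmorph_nat.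
  by rewrite rmorphN coef_map.
suff -> : map_poly io (\poly_(i < n.+2) (x i).+1%:R) =
    \poly_(i < n.+2) (if (i < n.+2)%N then (x i).+1%:R else q`_i) by [].
apply/polyP => i; rewrite coef_map !coef_poly; case: ifP => ik; last exact: rmorph0.
exact: rmorph_nat.
Qed.

(** * Polynomials with arbitrarily small values *)

Section Dense.
Variables (F : fieldType) (V : F -> Prop).
Hypotheses (V1 : V 1) (VB : forall x y, V x -> V y -> V (x - y)).
Hypotheses (VM : forall x y, V x -> V y -> V (x * y)).
Hypotheses (Vtot : forall x, V x \/ V x^-1).

Lemma ring_pred0 : V 0. Proof. by rewrite -(subrr 1); apply: VB. Qed.

Lemma ring_predD x y : V x -> V y -> V (x + y).
Proof. by move=> Vx Vy; rewrite -[y]opprK -[- y]sub0r; do 2!apply: VB => //; apply: ring_pred0. Qed.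

Lemma ring_pred_nat n : V n%:R.
Proof. by elim: n => [|n IH]; [exact: ring_pred0 | rewrite -natr1; apply: ring_predD]. Qed.

Lemma ring_pred_horner (p : {poly F}) b : (forall i, V p`_i) -> V b -> V p.[b].
Proof.
move=> Vp Vb; rewrite horner_coef; elim/big_ind: _ => [|x y|i _]; [exact: ring_pred0|exact: ring_predD|].
by apply: VM => //; elim: (i : nat) => [|j IH]; rewrite ?expr0 ?exprS//; apply: VM.
Qed.

(** The factor [e] is a common denominator of the coefficients of [q]. *)
Lemma bounded_horner (q : {poly F}) :
  exists e, [/\ e != 0, V e & forall b, V b -> V (e * q.[b])].
Proof.
elim/poly_ind: q => [|q c [e [e0 Ve eq]]].
  by exists 1; split=> [||b _]; rewrite ?oner_eq0// horner0 mulr0; apply: ring_pred0.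
have [e' [e'0 Ve' Vc]] : exists e', [/\ e' != 0, V e' & V (e' * c)].
  have [Vc|Vc] := Vtot c; first by exists 1; rewrite oner_eq0 mul1r.
  have [->|c0] := eqVneq c 0; first by exists 1; rewrite oner_eq0 mulr0; split=> //; apply: ring_pred0.
  by exists c^-1; rewrite invr_eq0 mulVf.
exists (e * e'); split=> [||b Vb]; [by rewrite mulf_neq0|exact: VM|].
rewrite hornerMXaddC (_ : _ * _ = e' * ((e * q.[b]) * b) + e * (e' * c)); last by ring.
by apply: ring_predD; apply: VM => //; apply: VM => //; apply: eq.
Qed.

(** As [V] is a valuation ring, this says that [g] takes arbitrarily small values on [B]. *)
Definition dense_on (B : F -> Prop) (g : {poly F}) :=
  forall d, d != 0 -> exists2 b, B b & V (g.[b] / d).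

(** If [g] is nowhere smaller than some [c] on [B], a value of the product below [c * d] forces one
    of [h] below [d]. *)
Lemma dense_factor B (g h : {poly F}) :
  dense_on B (g * h) -> dense_on B g \/ dense_on B h.
Proof.
move=> gh; have [|ng] := pselect (dense_on B g); [by left|right=> d d0].
have [c c0 gc] : exists2 c, c != 0 & forall b, B b -> ~ V (g.[b] / c).
  apply: contrapT => H; apply: ng => c c0; apply: contrapT => H'; apply: H.
  by exists c => // b Bb Vb; apply: H'; exists b.
have [|b Bb] := gh (c * d); first by rewrite mulf_neq0.
have [Vb|Vb] := Vtot (g.[b] / c); first by have := gc _ Bb Vb.
have g0 : g.[b] != 0.
  by apply: contra_notN (gc _ Bb) => /eqP ->; rewrite mul0r; apply: ring_pred0.
rewrite hornerM => H; exists b => //.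
rewrite (_ : _ / d = g.[b] * h.[b] / (c * d) * (g.[b] / c)^-1); first exact: VM.
by field; rewrite g0 c0 d0.
Qed.

(** Pass to a factor with small values until it is irreducible. It cannot be linear: [B] contains a
    ball of fixed radius [z] around each of its points, so the root would lie in [B]. *)
Lemma irreducible_dense (B : F -> Prop) (f : {poly F}) y z :
  ~ V y -> z != 0 -> (forall b, B b -> V b) ->
  (forall b c, B b -> V ((b - c) / z) -> B c) ->
  f != 0 -> (forall b, B b -> f.[b] != 0) -> dense_on B f ->
  exists g n, [/\ irreducible_poly g, g \is monic, size g = n.+3 & dense_on V g].
Proof.
move=> Vy z0 BV Bball.
have [n] := ubnP (size f); elim: n f => // n IH f; rewrite ltnS => sf f0 fB fd.
have y0 : y != 0 by apply: contra_not_neq Vy => ->; exact: ring_pred0.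
have f1 : (1 < size f)%N.
  rewrite ltnNge; apply/negP => /size1_polyC fE; move: f0; rewrite fE polyC_eq0 => c0.
  (* At this scale a constant polynomial gives the quotient [y], which is not in [V]. *)
  have [|b _] := fd (f`_0 / y); first by rewrite mulf_neq0// invr_eq0.
  rewrite fE hornerC; apply: contra_not Vy.
  by rewrite !coefC /= invfM invrK mulrA divff// mul1r.
have [irr|nirr] := pselect (irreducible_poly f); last first.
  have [q [q1 qf nqf]] : exists q : {poly F}, [/\ size q != 1%N, q %| f & ~~ (q %= f)].
    apply: contrapT => H; apply: nirr; split=> // q q1 qp; apply/negPn/negP => nq.
    by apply: H; exists q.
  have /dvdpP[r fE] := qf.
  have q0 : q != 0 by apply: contraNneq f0 => q0; rewrite fE q0 mulr0.
  have r0 : r != 0 by apply: contraNneq f0 => r0; rewrite fE r0 mul0r.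
  have sqf : (size q < size f)%N by rewrite ltn_neqAle dvdp_leq// andbT dvdp_size_eqp.
  have srf : (size r < size f)%N.
    have : (1 < size q)%N by move: q1 q0; rewrite -size_poly_gt0; case: (size q) => [|[]].
    rewrite fE size_mul//; case: (size q) => [|[|m]] //= _.
    by rewrite addnS /= addnS ltnS leq_addr.
  have rq b : B b -> r.[b] != 0 /\ q.[b] != 0.
    by move=> /fB; rewrite fE hornerM mulf_eq0 negb_or => /andP[].
  move: fd; rewrite fE => /dense_factor[] d.
    by apply: (IH r) => //; [exact: leq_trans sf|move=> b /rq[]].
  by apply: (IH q) => //; [exact: leq_trans sf|move=> b /rq[]].
pose c := lead_coef f.
have c0 : c != 0 by rewrite lead_coef_eq0.
have gd : dense_on B (c^-1 *: f).
  move=> d d0; have [|b Bb Vb] := fd (c * d); first by rewrite mulf_neq0.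
  by exists b => //; rewrite hornerZ (_ : _ / d = f.[b] / (c * d)) //; field; rewrite c0 d0.
exists (c^-1 *: f), (size f - 3)%N; split.
- split=> [|q q1]; first by rewrite size_scale ?invr_eq0.
  rewrite dvdpZr ?invr_eq0// => /(irr.2 q q1).
  by move/eqp_trans; apply; rewrite eqp_sym eqp_scale ?invr_eq0.
- by rewrite monicE lead_coefZ mulVf.
- rewrite size_scale ?invr_eq0//; case: (ltngtP (size f) 2) => sf2.
  + by move: f1; rewrite leqNgt sf2.
  + by rewrite -addn3 subnK.
  (* In degree 1 the quotient at scale [c * z] is the distance from [b] to the root, divided by
     [z]. *)
  + have [|b Bb Vb] := fd (c * z); first by rewrite mulf_neq0.
    have fE u : f.[u] = f`_0 + c * u.
      by rewrite horner_coef sf2 !big_ord_recl big_ord0 /= expr0 expr1 mulr1 addr0 /c lead_coefE sf2.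
    have : B (- (f`_0 / c)).
      apply: (Bball b) => //; rewrite (_ : _ / z = f.[b] / (c * z)) // fE.
      by field; rewrite c0 z0.
    by move=> /fB; rewrite fE mulrN mulrCA divff// mulr1 subrr eqxx.
- by move=> d /gd[b Bb Vb]; exists b => //; apply: BV.
Qed.

(** The composite of [gs] with an integer polynomial, which maps [V] to itself, is a multiple of
    [g], and the cofactor is bounded on [V]. *)
Lemma perturb_dense (g : {poly F}) n t :
  (forall n, n.+1%:R != 0 :> F) -> irreducible_poly g -> g \is monic -> size g = n.+3 ->
  dense_on V g -> nonzero_term n.+2 t ->
  exists gs : {poly F}, [/\ gs \is monic, size gs = n.+3, forall z, ~~ root gs z,
    dense_on V gs & teval (nth 0 (gs - 'X^(n.+2) : {poly F})) t != 0].
Proof.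
move=> char0 girr gm sg gd tn.
have [gs [x /= [[gsm ssg] nr /dvdpP[q qE] tgs]]] := irreducible_perturb char0 girr gm sg tn.
exists gs; split=> // d d0; have [e [e0 Ve eq]] := bounded_horner q.
have [|b Vb Vgb] := gd (d * e); first by rewrite mulf_neq0.
exists (\poly_(i < n.+2) (x i)%:R).[b].
  by apply: ring_pred_horner => // i; rewrite coef_poly; case: ifP => _; [exact: ring_pred_nat|exact: ring_pred0].
rewrite -horner_comp qE hornerM (_ : _ / d = (g.[b] / (d * e)) * (e * q.[b])).
  by apply: VM => //; apply: eq.
by field; rewrite d0 e0.
Qed.

End Dense.

(** * Integral closedness of valuation rings *)

Lemma polyOver_coef (L : fieldType) (A : set L) (p : {poly L}) :
  A 0 -> p \is a polyOver [in A] <-> forall i, A p`_i.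
Proof.
move=> A0; split=> [/allP pA i|pA].
  have [ip|ip] := ltnP i (size p); last by rewrite nth_default.
  by have := pA _ (mem_nth 0 ip); rewrite /= in_setE.
by apply/allP => _ /(nthP 0)[i _ <-]; rewrite /= in_setE.
Qed.

(** If [y] is not in [V], its inverse is; dividing the equation by a power of [y] then writes [y] in
    terms of the coefficients and of powers of this inverse. *)
Lemma monic_integral (F : fieldType) (V : F -> Prop) (p : {poly F}) y :
  V 1 -> (forall x y, V x -> V y -> V (x - y)) ->
  (forall x y, V x -> V y -> V (x * y)) -> (forall x, V x \/ V x^-1) ->
  p \is monic -> (forall i, V p`_i) -> root p y -> V y.
Proof.
move=> V1 VB VM Vtot pm pV py; have [//|Vy] := Vtot y.
have [->|y0] := eqVneq y 0; first exact: (ring_pred0 V1 VB).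
have VX m : V (y^-1 ^+ m) by elim: m => [|m IH]; rewrite ?expr0 ?exprS//; apply: VM.
have sp : size p = (size p).-2.+2.
  have p0 : (0 < size p)%N by rewrite size_poly_gt0 monic_neq0.
  suff : size p != 1%N by case: (size p) p0 => [|[]].
  apply: contraTneq py => p1; have pE := size1_polyC (eq_leq p1).
  by move: pm; rewrite pE monicE lead_coefC /root hornerC => /eqP ->; rewrite oner_eq0.
set m := (size p).-2 in sp.
have : y * y ^+ m = - \sum_(i < m.+1) p`_i * y ^+ i.
  apply/eqP; rewrite -exprS -addr_eq0 addrC; move: py; rewrite /root horner_coef sp big_ord_recr /=.
  by move: pm; rewrite monicE lead_coefE sp /= => /eqP ->; rewrite mul1r.
move/(congr1 (fun u => u * y^-1 ^+ m)); rewrite -mulrA -exprMn divff// expr1n mulr1 => ->.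
rewrite mulNr -sub0r; apply: (VB) => //; first exact: (ring_pred0 V1 VB).
rewrite mulr_suml; elim/big_ind: _ => [|? ?|i _]; [exact: (ring_pred0 V1 VB)|exact: (ring_predD V1 VB)|].
rewrite -mulrA; apply: VM => //; have im : (i <= m)%N by rewrite -ltnS.
rewrite (_ : y^-1 ^+ m = y^-1 ^+ i * y^-1 ^+ (m - i)); last by rewrite -exprD subnKC.
by rewrite mulrA -exprMn divff// expr1n mul1r.
Qed.

(** * Powers in a valued field of prohenselian degree 1 *)

Section ValuationIdeal.
Variables (K : fieldType) (G : oagType) (v : valuation K G).
Local Notation O := (val_ring v).
Local Notation M := (val_max v).
Implicit Types x y : K.

(** With this description through [O] alone, the facts about [M] below become ring-theoretic. *)
Lemma val_maxE x : (x \in M) = (x == 0) || (x^-1 \notin O).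
Proof.
have [->|x0] := eqVneq x 0; first by rewrite inE val_zero.
rewrite !inE /= /vlt; have := val_mul v x x^-1; rewrite divff// val_one.
have := val_infty v x; have := val_infty v x^-1; rewrite invr_eq0 (negPf x0).
case: (v x) (v x^-1) => [a|] [b|] //= _ _ [ab]; congr (~~ _).
apply/idP/idP => [a0|b0].
  by have := oag_leD2l b _ _ a0; rewrite addr0 addrC -ab.
by have := oag_leD2l a _ _ b0; rewrite addr0 -ab.
Qed.

Lemma val_ring_total x : x \in O \/ x^-1 \in O.
Proof.
have [xO|xO] := boolP (x^-1 \in O); [by right|left].
by apply: vltW; have : x \in M by rewrite val_maxE xO orbT.
Qed.

Lemma val_max_ring x : x \in M -> x \in O.
Proof. exact: vltW. Qed.

Lemma val_max0 : 0 \in M. Proof. by rewrite val_maxE eqxx. Qed.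

Lemma val_max1 : 1 \notin M. Proof. by rewrite val_maxE oner_eq0 invr1 rpred1. Qed.

Lemma val_max_inv x : x != 0 -> x \in M -> x^-1 \notin O.
Proof. by move=> x0; rewrite val_maxE (negPf x0). Qed.

Lemma val_unit x : x \notin M -> x^-1 \in O.
Proof. by rewrite val_maxE negb_or negbK => /andP[]. Qed.

Lemma val_ringN x : x \notin O -> x^-1 \in M.
Proof. by move=> xO; rewrite val_maxE invrK xO orbT. Qed.

Lemma val_maxM x y : x \in O -> y \in M -> x * y \in M.
Proof.
move=> xO yM; rewrite val_maxE; have [//|/=] := eqVneq (x * y) 0.
rewrite mulf_eq0 negb_or => /andP[x0 y0]; apply: contra (val_max_inv y0 yM) => xy.
by rewrite (_ : y^-1 = x * (x * y)^-1) ?rpredM//; field; rewrite x0 y0.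
Qed.

Lemma val_maxMl x y : x \in M -> y \in O -> x * y \in M.
Proof. by move=> xM yO; rewrite mulrC val_maxM. Qed.

Lemma val_maxD x y : x \in M -> y \in M -> x + y \in M.
Proof.
move=> xM yM; have [->|y0] := eqVneq y 0; first by rewrite addr0.
have [->|x0] := eqVneq x 0; first by rewrite add0r.
have [H|] := val_ring_total (x / y).
  rewrite (_ : x + y = (x / y + 1) * y); last by field.
  by rewrite val_maxM// rpredD ?rpred1.
rewrite invfM invrK mulrC => H; rewrite (_ : x + y = (1 + y / x) * x); last by field.
by rewrite val_maxM// rpredD ?rpred1.
Qed.

Lemma val_maxN x : x \in M -> - x \in M.
Proof. by move=> xM; rewrite -mulN1r val_maxM// rpredN rpred1. Qed.

Lemma val_ring_horner (p : {poly K}) y :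
  (forall i, p`_i \in O) -> y \in O -> p.[y] \in O.
Proof.
move=> pO yO; rewrite horner_coef rpred_sum// => i _.
by rewrite rpredM// rpredX.
Qed.

Lemma val_unitD u x : u \notin M -> x \in M -> u + x \notin M.
Proof.
by move=> uM xM; apply: contra uM => uxM; rewrite -[u](addrK x) val_maxD ?val_maxN.
Qed.

End ValuationIdeal.

Section Powers.
Variables (K : fieldType) (G : oagType) (v : valuation K G).
Local Notation O := (val_ring v).
Local Notation M := (val_max v).

Hypothesis char_residue : [pchar (residue_field v)] =i pred0.

(** Primes are units because the residue characteristic is 0; in general, split off the least prime
    factor. *)
Lemma nat_unit n : n.+1%:R \notin M.
Proof.
have pM p : prime p -> p%:R \notin M.
  move=> pp; have := char_residue p; rewrite !inE pp /= => /negbT; apply: contra => pM.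
  rewrite -(rmorph_nat (\pi_(residue_field v))%qT) -(rmorph0 (\pi_(residue_field v))%qT).
  rewrite -Quotient.idealrBE subr0.
  suff -> : (p%:R \in res_ideal v) = (p%:R \in M) by [].
  by rewrite inE (rmorph_nat (val : val_ring_type v -> K)).
elim/ltn_ind: n => [[|n] IH]; first exact: val_max1.
have p2 := pdiv_prime (isT : (1 < n.+2)%N); have := divnK (pdiv_dvd n.+2).
case: (n.+2 %/ _)%N (divn_gt0 n.+2 (prime_gt0 p2)) => [|m] mE nE.
  by move: nE; rewrite mul0n.
rewrite -nE natrM; apply: contra (IH m _) => [H|].
  rewrite -[_%:R](mulfK (_ : (pdiv n.+2)%:R != 0)).
    by rewrite val_maxMl// val_unit// pM.
  by apply: contraNneq (pM _ p2) => ->; apply: val_max0.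
rewrite -ltnS -[X in (_ < X)%N]nE ltn_Pmulr// prime_gt1//.
Qed.

Lemma nat_neq0 n : n.+1%:R != 0 :> K.
Proof. by apply: contraNneq (nat_unit n) => ->; apply: val_max0. Qed.

Lemma int_unit (m : int) : m != 0 -> m%:~R \notin M.
Proof.
case: m => [[|m]|m] //= _; first exact: nat_unit.
by rewrite NegzE rmorphN; apply: contra (nat_unit m) => /val_maxN; rewrite opprK.
Qed.

Variable t : K.
Hypotheses (tM : t \in M) (t0 : t != 0).

Local Notation "p {{ t }}" := (map_poly intr p).[t] (at level 2).

Lemma int_horner_ring (p : {poly int}) : p{{t}} \in O.
Proof.
by apply: val_ring_horner (val_max_ring tM) => i; rewrite coef_map rpred_int.
Qed.

(** Dividing by powers of [t] leads to a nonzero constant coefficient, and then the value is a unit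
    of [O]. *)
Lemma int_horner_val_bound (p : {poly int}) : p != 0 ->
  exists N, p{{t}} != 0 /\ t ^+ N / p{{t}} \in O.
Proof.
elim/poly_ind: p => [|p c IH]; first by rewrite eqxx.
move=> pc0; rewrite rmorphD rmorphM /= map_polyX map_polyC /= hornerMXaddC.
have [c0|c0] := eqVneq c 0; last first.
  exists 0; have : p{{t}} * t + c%:~R \notin M.
    by rewrite addrC val_unitD ?int_unit// val_maxM ?int_horner_ring.
  by move=> H; rewrite expr0 div1r val_unit//; split=> //; apply: contraNneq H => ->; apply: val_max0.
have p0 : p != 0 by apply: contraNneq pc0 => ->; rewrite c0 mul0r add0r.
have [N [pt0 H]] := IH p0; exists N.+1; rewrite c0 rmorph0 addr0 mulf_neq0//; split=> //.
by rewrite (_ : _ / _ = t ^+ N / p{{t}}) ?exprS//; field; rewrite t0 pt0.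
Qed.

(** Elements of Q(t) are quotients of integer polynomials in [t], and the value of the denominator
    is bounded by a multiple of that of [t]. *)
Lemma gen_field_bound x : gen_field (range (fun _ : 'I_1 => t)) x ->
  exists N, t ^+ N * x \in O.
Proof.
pose D : set K := [set x | exists p q : {poly int}, q != 0 /\ x = p{{t}} / q{{t}}]%classic.
move=> /(_ D)[].
- split; rewrite ?in_setE.
  + by exists 1, 1; rewrite oner_eq0 rmorph1 hornerC divr1.
  + move=> x1 x2; rewrite !in_setE => -[p1 [q1 [q10 ->]]] [p2 [q2 [q20 ->]]].
    exists (p1 * q2 - p2 * q1), (q1 * q2); rewrite mulf_neq0//; split=> //.
    have [_ [n1 _]] := int_horner_val_bound q10; have [_ [n2 _]] := int_horner_val_bound q20.
    by rewrite rmorphB !rmorphM /= !hornerE; field; rewrite n1 n2.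
  + move=> x1 x2; rewrite !in_setE => -[p1 [q1 [q10 ->]]] [p2 [q2 [q20 ->]]].
    (* Division by zero gives 0, which must belong to the set too. *)
    have [->|p20] := eqVneq p2 0.
      by exists 0, 1; rewrite oner_eq0 !rmorph0 horner0 !mul0r invr0 mulr0.
    exists (p1 * q2), (q1 * p2); rewrite mulf_neq0//; split=> //.
    have [_ [n1 _]] := int_horner_val_bound q10; have [_ [n2 _]] := int_horner_val_bound q20.
    have [_ [n3 _]] := int_horner_val_bound p20.
    by rewrite !rmorphM /= !hornerE; field; rewrite n1 n2 n3.
- move=> _ [i _ <-]; exists 'X, 1.
  by rewrite oner_eq0 map_polyX hornerX rmorph1 hornerC divr1.
move=> p [q [q0 ->]]; have [N [_ H]] := int_horner_val_bound q0.
by exists N; rewrite mulrCA rpredM ?int_horner_ring.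
Qed.

Let D := gen_field (range (fun _ : 'I_1 => t)).
Let E := alg_closure_in D.

Lemma gen_field_closed : GRing.divring_closed [in D].
Proof.
split.
- by rewrite in_setE => A [A1 _ _] _; rewrite -in_setE.
- move=> x y; rewrite !in_setE => Dx Dy A cA sA; have [_ H _] := cA; have := H x y; rewrite !in_setE.
  by apply; [exact: Dx|exact: Dy].
- move=> x y; rewrite !in_setE => Dx Dy A cA sA; have [_ _ H] := cA; have := H x y; rewrite !in_setE.
  by apply; [exact: Dx|exact: Dy].
Qed.

Let D1 : D 1. Proof. by have [] := gen_field_closed; rewrite in_setE. Qed.
Let DB x y : D x -> D y -> D (x - y).
Proof. by have [_ H _] := gen_field_closed; have := H x y; rewrite !in_setE. Qed.
Let Dd x y : D x -> D y -> D (x / y).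
Proof. by have [_ _ H] := gen_field_closed; have := H x y; rewrite !in_setE. Qed.
Let DV x : D x -> D x^-1. Proof. by rewrite -div1r; apply: Dd. Qed.
Let DM x y : D x -> D y -> D (x * y).
Proof. by move=> Dx Dy; rewrite -[y]invrK; apply: Dd => //; apply: DV. Qed.
Let DX x n : D x -> D (x ^+ n).
Proof. by move=> Dx; elim: n => [|n IH]; rewrite ?expr0 ?exprS//; apply: DM. Qed.
Let Dt : D t. Proof. by move=> A _; apply; exists ord0. Qed.

Lemma gen_field_alg x : D x -> E x.
Proof.
move=> Dx; exists ('X - x%:P); split; rewrite ?polyXsubC_eq0 ?root_XsubC//.
apply/polyOver_coef; first exact: (ring_pred0 D1 DB).
move=> i; rewrite coefB coefX coefC; apply: DB; first exact: (ring_pred_nat D1 DB).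
by case: eqP => // _; exact: (ring_pred0 D1 DB).
Qed.

Lemma alg_scale N x : E x -> E (t ^+ N * x).
Proof.
have tN0 : t ^+ N != 0 by rewrite expf_neq0.
move=> [p [/polyOver_coef pD p0 px]]; exists (\poly_(i < size p) (p`_i * (t ^+ N)^-1 ^+ i)); split.
- apply/polyOver_coef; first exact: (ring_pred0 D1 DB).
  move=> i; rewrite coef_poly; case: ifP => _; last exact: (ring_pred0 D1 DB).
  by apply: DM; [exact: (pD (ring_pred0 D1 DB))|apply: DX; apply: DV; exact: DX].
- apply: contraNneq p0 => /(congr1 (fun q : {poly K} => q`_(size p).-1)).
  rewrite coef_poly coef0 -lead_coefE; case: ltnP => [_ /eqP|].
    by rewrite mulf_eq0 expf_eq0 invr_eq0 (negPf tN0) andbF orbF lead_coef_eq0.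
  by rewrite -size_poly_eq0; case: (size p) => //= n; rewrite ltnn.
- move: px; rewrite /root horner_poly horner_coef => /eqP px; apply/eqP; rewrite -[RHS]px.
  by apply: eq_bigr => i _; rewrite exprMn -mulrA (mulrA (_ ^-1 ^+ _)) -exprMn mulVf// expr1n mul1r.
Qed.

(** Multiplying [x] by a large power of [t] makes it integral over [O], as the coefficients of its
    equation lie in Q(t) and are bounded. *)
Lemma alg_bound x : E x -> exists N, t ^+ N * x \in O.
Proof.
move=> [p [/polyOver_coef pD p0 px]]; have {}pD := pD (ring_pred0 D1 DB).
set n := (size p).-1; pose c := lead_coef p.
have c0 : c != 0 by rewrite lead_coef_eq0.
have [N Nb] : exists N, forall i, (i <= n)%N -> t ^+ N * (p`_i / c) \in O.
  elim: (n) => [|m [N IH]].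
    have [N H] := gen_field_bound (Dd (pD 0%N) (pD (size p).-1)).
    by exists N => i; rewrite leqn0 => /eqP ->.
  have [N' H] := gen_field_bound (Dd (pD m.+1) (pD (size p).-1)).
  exists (N + N')%N => i; rewrite leq_eqVlt => /orP[/eqP ->|lt].
    by rewrite exprD -mulrA rpredM// rpredX// val_max_ring.
  by rewrite addnC exprD -mulrA rpredM// ?IH// rpredX// val_max_ring.
have sp : size p = n.+1 by rewrite /n prednK// size_poly_gt0.
exists N; set y := t ^+ N * x.
(* With T = [t ^+ N], the polynomial [q] is T^n p(X/T)/c, which is monic and vanishes at [y]. *)
pose r : {poly K} := \poly_(i < n) (p`_i / c * (t ^+ N) ^+ (n - i)).
pose q := 'X^n + r.
have sq : (size r < n.+1)%N by rewrite ltnS size_poly.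
apply: (@monic_integral _ (fun x => x \in O) q).
- exact: rpred1.
- by move=> ? ?; exact: rpredB.
- by move=> ? ?; exact: rpredM.
- exact: val_ring_total.
- by rewrite monicE lead_coefDl ?size_polyXn// lead_coefXn.
- move=> i; rewrite coefD coefXn coef_poly rpredD ?rpred_nat//.
  case: ltnP => ni; last exact: rpred0.
  rewrite -(subnSK ni) exprS mulrA; apply: rpredM.
    by rewrite mulrC Nb// ltnW.
  by do 2!apply: rpredX; apply: val_max_ring.
- rewrite /root hornerD hornerXn horner_poly; apply/eqP.
  have : (t ^+ N) ^+ n * (p.[x] / c) = 0 by rewrite (eqP px) mul0r mulr0.
  rewrite horner_coef sp mulr_suml mulr_sumr big_ord_recr /= => H; rewrite -[RHS]H.
  rewrite [LHS]addrC; congr (_ + _); last first.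
    by rewrite -[p`_n]/c /y exprMn mulrAC divff// mul1r.
  apply: eq_bigr => i _; rewrite /y exprMn.
  have -> : (t ^+ N) ^+ n = (t ^+ N) ^+ (n - i) * (t ^+ N) ^+ i.
    by rewrite -exprD subnK// ltnW.
  by field.
Qed.

(** The henselian coarsening R' is proper, so [t] is not a unit in it, and Hensel's lemma in R'
    applies to X^k - (1 + t) at 1. *)
Lemma one_add_max_pow k : prohenselian v 2 -> (0 < k)%N -> exists b, 1 + t = b ^+ k.
Proof.
move=> pro; case: k => // k _.
have [] := pro 1%N isT (fun=> t).
- by [].
- by move=> i j; rewrite !ord1.
rewrite -/D -/E => R' [[[R'E ER'] [R1 RB RM] Rtot] hens RR'].
have {}R1 : R' 1 by move: R1; rewrite in_setE.
have {}RB x y : R' x -> R' y -> R' (x - y) by have := RB x y; rewrite !in_setE.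
have {}RM x y : R' x -> R' y -> R' (x * y) by have := RM x y; rewrite !in_setE.
have DR x : D x -> x \in O -> R' x.
  by move=> Dx xO; apply: RR'; split=> //; apply: gen_field_alg.
have Rt : R' t by apply: DR => //; apply: val_max_ring.
have nRt : ~ R' t^-1.
  (* With 1/t in R', every element of [E] would lie in R', since a power of [t] brings it into
     [O]. *)
  move=> Rt'; apply: ER' => y Ey; have [N H] := alg_bound Ey.
  have RNy : R' (t ^+ N * y) by apply: RR'; split=> //; apply: alg_scale.
  rewrite (_ : y = t^-1 ^+ N * (t ^+ N * y)); last by rewrite mulrA -exprMn mulVf// expr1n mul1r.
  by apply: (RM) => //; elim: N {H RNy} => [|N IH]; rewrite ?expr0 ?exprS//; apply: (RM).
have Rk : R' k.+1%:R by exact: (ring_pred_nat R1 RB).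
have Rk' : R' k.+1%:R^-1.
  apply: DR; first by apply: DV; exact: (ring_pred_nat D1 DB).
  exact: val_unit (nat_unit k).
have [|||  |b [_ b0 _]] := hens ('X^(k.+1) - (1 + t)%:P) 1 => //.
- apply/polyOver_coef; first exact: (ring_pred0 R1 RB).
  move=> i; rewrite coefB coefXn coefC; apply: (RB); first exact: (ring_pred_nat R1 RB).
  by case: eqP => _; [exact: (ring_predD R1 RB)|exact: (ring_pred0 R1 RB)].
- rewrite hornerD hornerN hornerXn hornerC expr1n opprD addrA subrr sub0r.
  split; first by rewrite -sub0r; apply: (RB) => //; exact: (ring_pred0 R1 RB).
  by case=> _; rewrite invrN => H; apply: nRt; rewrite -[_^-1]opprK -sub0r; apply: (RB) => //; exact: (ring_pred0 R1 RB).
- rewrite derivB derivC subr0 derivXn hornerMn hornerXn expr1n; case=> _; apply; split=> //.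
  exact: nat_neq0.
- by exists b; apply/eqP; rewrite eq_sym -subr_eq0 -b0 !hornerE.
Qed.

End Powers.

(** * Residue fields *)

(** The ring may be all of [K], as happens for the coarsening when H is the whole value group. *)
Record valuation_subring (K : fieldType) := ValuationSubring {
  vsub_pred :> {pred K};
  vsub_closed : GRing.subring_closed vsub_pred;
  vsub_total : forall x, x \in vsub_pred \/ x^-1 \in vsub_pred
}.

Section ResidueField.
Variables (K : fieldType) (A : valuation_subring K).

HB.instance Definition _ := GRing.isSubringClosed.Build K (vsub_pred A) (vsub_closed A).

Definition vsub_type : predArgType := {x : K | x \in vsub_pred A}.
HB.instance Definition _ := SubChoice.on vsub_type.
HB.instance Definition _ := [SubChoice_isSubComNzRing of vsub_type by <:].

Definition vsub_ideal : {pred vsub_type} :=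
  [pred x | (val x == 0) || ((val x)^-1 \notin A)].

Lemma vsub_ideal_closed : idealr_closed vsub_ideal.
Proof.
have VB x y : x \in A -> y \in A -> x - y \in A by move=> ? ?; rewrite rpredB.
have VM x y : x \in A -> y \in A -> x * y \in A by move=> ? ?; rewrite rpredM.
have idealM (x y : K) : x \in A -> (y == 0) || (y^-1 \notin A) ->
    (x * y == 0) || ((x * y)^-1 \notin A).
  move=> xA; have [->|y0] := eqVneq y 0; first by rewrite mulr0 eqxx.
  have [//|/=] := eqVneq (x * y) 0; rewrite mulf_eq0 negb_or => /andP[x0 _].
  apply: contra => xy; rewrite (_ : y^-1 = x * (x * y)^-1) ?rpredM//.
  by field; rewrite x0 y0.
have idealD (x y : K) : (x == 0) || (x^-1 \notin A) -> (y == 0) || (y^-1 \notin A) ->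
    (x + y == 0) || ((x + y)^-1 \notin A).
  have [->|x0] := eqVneq x 0; first by rewrite add0r.
  have [->|y0] := eqVneq y 0; first by rewrite addr0 (negPf x0).
  move=> xI yI; have [H|] := vsub_total A (x / y).
    rewrite (_ : x + y = (x / y + 1) * y); last by field.
    by apply: idealM; rewrite ?(negPf y0)// rpredD ?rpred1.
  rewrite invfM invrK mulrC => H; rewrite (_ : x + y = (1 + y / x) * x); last by field.
  by apply: idealM; rewrite ?(negPf x0)// rpredD ?rpred1.
split=> [||a x y]; rewrite !inE /=.
- by rewrite eqxx.
- by rewrite oner_eq0 invr1 rpred1.
- by move=> xI yI; apply: idealD => //; apply: idealM => //; exact: (valP a).
Qed.

HB.instance Definition _ := isIdealr.Build vsub_type vsub_ideal vsub_ideal_closed.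

Definition vsub_residue := {ideal_quot vsub_ideal}.
HB.instance Definition _ := GRing.ComNzRing.on vsub_residue.

Let pi : vsub_type -> vsub_residue := \pi_(vsub_residue)%qT.

Lemma vsub_pi_eq0 x : (pi x == 0) = (val x == 0) || ((val x)^-1 \notin A).
Proof.
rewrite -(rmorph0 (\pi_(vsub_residue)%qT)) /pi -Quotient.idealrBE subr0.
by [].
Qed.

Lemma vsub_residue_inv (y : vsub_residue) : exists z, (y != 0 -> z * y = 1) /\ (y = 0 -> z = 0).
Proof.
have [->|y0] := eqVneq y 0; first by exists 0.
have yE := reprK y; set x := repr y in yE.
have : pi x != 0 by rewrite /pi yE.
rewrite vsub_pi_eq0 negb_or negbK => /andP[x0 xA].
exists (pi (exist (fun x => x \in vsub_pred A) _ xA)); split; last by move=> y00; case/eqP: y0.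
move=> _; rewrite -yE -rmorphM -(rmorph1 (\pi_(vsub_residue)%qT)).
by congr (\pi_(vsub_residue)%qT _); apply: val_inj; rewrite /= mulVf.
Qed.

Definition vsub_inv (y : vsub_residue) : vsub_residue :=
  projT1 (cid (vsub_residue_inv y)).

Lemma vsub_mulVf y : y != 0 -> vsub_inv y * y = 1.
Proof. by rewrite /vsub_inv; case: cid => z [/= zy _] /zy. Qed.

Lemma vsub_inv0 : vsub_inv 0 = 0.
Proof. by rewrite /vsub_inv; case: cid => z [/= _ ->]. Qed.

HB.instance Definition _ := GRing.ComNzRing_isField.Build vsub_residue vsub_mulVf vsub_inv0.

(** Presents [A] by a ring with an embedding into [K] and a residue map onto a field, hiding the
    quotient construction. *)
Lemma residue_place : exists (R : comNzRingType) (F : fieldType)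
    (i : {rmorphism R -> K}) (p : {rmorphism R -> F}),
  [/\ injective i, forall x, x \in A -> exists r, i r = x, forall r, i r \in A,
      forall y, exists r, p r = y &
      forall r, (p r == 0) = (i r == 0) || ((i r)^-1 \notin A)].
Proof.
exists vsub_type, vsub_residue, (val : vsub_type -> K), (\pi_(vsub_residue)%qT).
split.
- exact: val_inj.
- by move=> x xA; exists (exist (fun x => x \in vsub_pred A) x xA).
- by move=> r; apply: valP.
- by move=> y; exists (repr y); exact: reprK.
- exact: vsub_pi_eq0.
Qed.

End ResidueField.

(** * Quantifier-free formulas *)

Section Formulas.
Variables (K : fieldType) (G : oagType) (v : valuation K G).
Local Notation O := (val_ring v).
Local Notation M := (val_max v).
Local Notation MK := (mac_of_valued_field v).

(** Equality up to a factor in 1 + M. *)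
Definition close (x y : K) := (x = 0 /\ y = 0) \/ (x != 0 /\ y / x - 1 \in M).

Fixpoint atoms (f : mac_formula) : seq mac_term :=
  match f with
  | FEq t1 t2 => [:: TAdd t1 (TOpp t2)]
  | FVal t | FPow _ t => [:: t]
  | FNot f1 | FForall _ f1 | FExists _ f1 => atoms f1
  | FAnd f1 f2 | FOr f1 f2 | FImp f1 f2 => atoms f1 ++ atoms f2
  | FFalse => [::]
  end.

Lemma eval_termE (e : nat -> K) t : @eval_term MK e t = teval e t.
Proof. by elim: t => //= [t1 -> t2 ->|t ->|t1 -> t2 ->]. Qed.

Lemma close_unit x y : x != 0 -> y / x - 1 \in M ->
  exists2 m, m \in M & y = x * (1 + m) /\ 1 + m \notin M.
Proof.
move=> x0 yx; exists (y / x - 1) => //; split; first by rewrite addrC subrK mulrC divfK.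
by apply: val_unitD yx; apply: val_max1.
Qed.

Lemma In_cat (T : Type) (x : T) s1 s2 :
  List.In x (s1 ++ s2) <-> List.In x s1 \/ List.In x s2.
Proof. by elim: s1 => /= [|y s1 IH]; [split; [right|case]|rewrite IH; tauto]. Qed.

(** A factor in 1 + M is a unit of [O] and a power of every exponent, so it affects neither
    vanishing nor membership in [O] or in the sets of powers. *)
Lemma satisfies_close (f : mac_formula) (e e' : nat -> K) :
  (forall m k, m \in M -> exists b, 1 + m = b ^+ k.+1) ->
  quantifier_free f ->
  (forall t, List.In t (atoms f) -> close (teval e t) (teval e' t)) ->
  @satisfies MK e f <-> @satisfies MK e' f.
Proof.
move=> powM; elim: f => //=.
- move=> t1 t2 _ /(_ _ (or_introl erefl)) /=; rewrite !eval_termE => -[[h1 h2]|[x0 yx]].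
    by split=> _; apply/eqP; rewrite -subr_eq0 ?h1 ?h2.
  have [m mM [yE mu]] := close_unit x0 yx.
  split=> /eqP; rewrite -subr_eq0; first by rewrite (negPf x0).
  rewrite yE mulf_eq0 (negPf x0) /= => /eqP m0; move: mu; rewrite m0.
  by rewrite val_max0.
- move=> t _ /(_ _ (or_introl erefl)); rewrite !eval_termE => -[[-> ->]//|[x0 yx]].
  have [m mM [-> mu]] := close_unit x0 yx.
  have m1 : 1 + m \in O by rewrite rpredD ?rpred1// val_max_ring.
  split=> H; first by rewrite rpredM.
  rewrite -[teval e t](mulfK (_ : 1 + m != 0)); last first.
    by apply: contraNneq mu => ->; apply: val_max0.
  by rewrite rpredM// val_unit.
- move=> k t _ /(_ _ (or_introl erefl)); rewrite !eval_termE => -[[-> ->]//|[x0 yx]].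
  have [m mM [-> mu]] := close_unit x0 yx.
  have m0 : 1 + m != 0 by apply: contraNneq mu => ->; apply: val_max0.
  have [b bE] := powM m k.+1 mM; have b0 : b != 0.
    by apply: contraNneq m0 => b0; rewrite bE b0 expr0n.
  split=> -[_ [y yE]]; split; rewrite ?mulf_neq0//.
    by exists (y * b); rewrite yE bE exprMn.
  by exists (y / b); rewrite expr_div_n -yE -bE mulfK.
- by move=> f IH qf H; rewrite IH.
- move=> f IHf g IHg /andP[qf qg] H.
  by rewrite IHf// ?IHg// => t ft; apply: H; apply/In_cat; [right|left].
- move=> f IHf g IHg /andP[qf qg] H.
  by rewrite IHf// ?IHg// => t ft; apply: H; apply/In_cat; [right|left].
- move=> f IHf g IHg /andP[qf qg] H.
  by rewrite IHf// ?IHg// => t ft; apply: H; apply/In_cat; [right|left].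
Qed.

Fixpoint pow_term (i n : nat) : mac_term :=
  if n is m.+1 then TMul (TVar i) (pow_term i m) else TOne.

(** Variable [k] is the unknown, the variables below it are the coefficients. *)
Fixpoint monic_term (k m : nat) : mac_term :=
  if m is j.+1 then TAdd (monic_term k j) (TMul (TVar j) (pow_term k j)) else pow_term k k.

(* [X^k + a_(k-1) X^(k-1) + ... + a_0] has a root; the coefficient [a_i] is variable [i]. *)
Definition has_root_formula k := FExists k (FEq (monic_term k k) TZero).

Lemma has_root_formulaP k (q : {poly K}) : (size q <= k)%N ->
  @satisfies MK (nth 0 q) (has_root_formula k) <-> exists x, root ('X^k + q) x.
Proof.
move=> sq; rewrite /has_root_formula /=.
suff tE x : @eval_term MK (@update MK (nth 0 q) k x) (monic_term k k) = ('X^k + q).[x].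
  by split=> -[x H]; exists x; move: H; rewrite tE => /eqP.
have pE n : @eval_term MK (@update MK (nth 0 q) k x) (pow_term k n) = x ^+ n.
  by elim: n => //= n ->; rewrite /update eqxx exprS.
rewrite hornerD hornerXn (horner_coef_wide _ sq).
suff H j : (j <= k)%N -> @eval_term MK (@update MK (nth 0 q) k x) (monic_term k j) =
    x ^+ k + \sum_(i < j) q`_i * x ^+ i by exact: H.
elim: j => [|j IH] jk /=; first by rewrite big_ord0 addr0 pE.
rewrite big_ord_recr /= addrA -IH ?(ltnW jk)// pE /update.
by rewrite ltn_eqF.
Qed.

End Formulas.

(** * The coarsening attached to a failure of Hensel's lemma *)

Section HenselFailure.
Variables (K : fieldType) (G : oagType) (v : valuation K G).
Local Notation O := (val_ring v).
Local Notation M := (val_max v).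

Lemma taylor2 (p : {poly K}) x h : (forall i, p`_i \in O) -> x \in O -> h \in O ->
  exists2 r, r \in O & p.[x + h] = p.[x] + h * p^`().[x] + h ^+ 2 * r.
Proof.
move=> pO xO hO; elim/poly_ind: p pO => [|p c IH] pO.
  by exists 0; rewrite ?rpred0// deriv0 !horner0 !mulr0 !addr0.
have pO' i : p`_i \in O.
  by have := pO i.+1; rewrite coefD coefMX coefC /= addr0.
have [r rO rE] := IH pO'.
exists (p^`().[x] + r * (x + h)).
  rewrite rpredD ?rpredM ?rpredD//; apply: val_ring_horner => // i.
  by rewrite coef_deriv rpredMn.
by rewrite derivMXaddC !hornerE rE; ring.
Qed.

Variables (f : {poly K}) (a : K).
Hypotheses (fO : forall i, f`_i \in O) (aO : a \in O).
Hypotheses (fa : f.[a] \in M) (f'a : f^`().[a] \notin M).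
Hypothesis noroot : forall b, b - a \in M -> f.[b] != 0.

Lemma disc_ring b : b - a \in M -> b \in O.
Proof. by move=> ba; rewrite -(subrK a b) rpredD// val_max_ring. Qed.

Lemma disc_horner (p : {poly K}) b : (forall i, p`_i \in O) -> b - a \in M ->
  p.[b] - p.[a] \in M.
Proof.
move=> pO ba; have [r rO] := taylor2 pO aO (val_max_ring ba).
rewrite addrC subrK => ->; rewrite addrAC [_ + _ - _]addrAC subrr add0r.
rewrite expr2 -mulrA; apply: val_maxD; apply: val_maxMl => //.
  by apply: val_ring_horner => // i; rewrite coef_deriv rpredMn.
by rewrite rpredM// val_max_ring.
Qed.

(** One step b - f(b)/f'(b): the linear terms of the Taylor expansion cancel and a multiple of
    f(b)^2 remains. *)
Lemma newton b : b - a \in M ->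
  exists2 b', b' - a \in M & f.[b'] / f.[b] ^+ 2 \in O.
Proof.
move=> ba; have f'O i : f^`()`_i \in O by rewrite coef_deriv rpredMn.
have fb : f.[b] \in M by rewrite -(subrK f.[a] f.[b]) val_maxD// disc_horner.
have f'b : f^`().[b] \notin M.
  by rewrite -(subrK f^`().[a] f^`().[b]) addrC val_unitD// disc_horner.
have f'b0 : f^`().[b] != 0 by apply: contraNneq f'b => ->; apply: val_max0.
pose h := - (f.[b] / f^`().[b]).
have hM : h \in M by rewrite val_maxN// val_maxMl// val_unit.
have [r rO rE] := taylor2 fO (disc_ring ba) (val_max_ring hM).
exists (b + h); first by rewrite addrAC val_maxD.
rewrite rE (_ : _ / _ = (f^`().[b]^-1) ^+ 2 * r); last first.
  by rewrite /h; field; rewrite f'b0 noroot.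
by rewrite rpredM// rpredX// val_unit.
Qed.

(* [v u] is at most [v (f b)] for some [b] in the residue disc of [a]. The values of
   [f] on this disc generate a convex subgroup, since Newton's iteration doubles them;
   [shallow] holds for the elements of [O] whose value lies in it; [u != 0] is needed
   because [x / 0 = 0]. *)
Definition shallow (u : K) :=
  [/\ u != 0, u \in O & exists2 b, b - a \in M & f.[b] / u \in O].

Lemma shallow_horner b : b - a \in M -> shallow f.[b].
Proof.
move=> ba; split; [exact: noroot|exact/val_ring_horner/disc_ring|].
by exists b => //; rewrite divff ?rpred1// noroot.
Qed.

Lemma shallow1 : shallow 1.
Proof.
split; [exact: oner_neq0|exact: rpred1|exists a; first by rewrite subrr val_max0].
by rewrite divr1 val_max_ring.
Qed.

(** Of the two points, the one where [f] is smaller serves both factors; a Newton step from it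
    doubles the value and so serves the product. *)
Lemma shallowM u w : shallow u -> shallow w -> shallow (u * w).
Proof.
have aux u' w' b : u' != 0 -> w' != 0 -> u' \in O -> w' \in O -> b - a \in M ->
    f.[b] / u' \in O -> f.[b] / w' \in O -> shallow (u' * w').
  move=> u0 w0 uO wO ba bu bw; split; rewrite ?mulf_neq0 ?rpredM//.
  have [b' b'a H] := newton ba; exists b' => //.
  have -> : f.[b'] / (u' * w') = f.[b'] / f.[b] ^+ 2 * ((f.[b] / u') * (f.[b] / w')).
    by field; rewrite u0 w0 noroot.
  by apply: rpredM => //; apply: rpredM.
move=> [u0 uO [b ba bu]] [w0 wO [c ca cw]].
have b0 := noroot ba; have c0 := noroot ca.
have [H|] := val_ring_total v (f.[b] / f.[c]).
  apply: (aux _ _ b) => //.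
  have -> : f.[b] / w = f.[b] / f.[c] * (f.[c] / w) by field; rewrite c0 w0.
  exact: rpredM.
rewrite invfM invrK mulrC => H; apply: (aux _ _ c) => //.
have -> : f.[c] / u = f.[c] / f.[b] * (f.[b] / u) by field; rewrite b0 u0.
exact: rpredM.
Qed.

(** The localisation of [O] at the shallow elements: the valuation ring of the coarsening of [v] by
    H. *)
Definition coarse : {pred K} := [pred x | `[< exists2 u, shallow u & u * x \in O >]].

Lemma coarseP x : reflect (exists2 u, shallow u & u * x \in O) (x \in coarse).
Proof. by rewrite inE; apply: asboolP. Qed.

Lemma ring_coarse x : x \in O -> x \in coarse.
Proof. by move=> xO; apply/coarseP; exists 1; [exact: shallow1|rewrite mul1r]. Qed.

Lemma coarse_closed : GRing.subring_closed coarse.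
Proof.
split=> [|x y /coarseP[u uS ux] /coarseP[w wS wy]|x y /coarseP[u uS ux] /coarseP[w wS wy]].
- exact/ring_coarse/rpred1.
- apply/coarseP; exists (u * w); first exact: shallowM.
  have [_ uO _] := uS; have [_ wO _] := wS.
  have -> : u * w * (x - y) = w * (u * x) - u * (w * y) by ring.
  by apply: rpredB; apply: rpredM.
- apply/coarseP; exists (u * w); first exact: shallowM.
  have -> : u * w * (x * y) = (u * x) * (w * y) by ring.
  exact: rpredM.
Qed.

Lemma coarse_total x : x \in coarse \/ x^-1 \in coarse.
Proof. by have [/ring_coarse|/ring_coarse] := val_ring_total v x; [left|right]. Qed.

Lemma shallow_inv u : shallow u -> u^-1 \in coarse.
Proof. by move=> uS; apply/coarseP; exists u => //; have [u0] := uS; rewrite divff// rpred1. Qed.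

Lemma coarse_den (p : {poly K}) : (forall i, p`_i \in coarse) ->
  exists2 u, shallow u & forall i, u * p`_i \in O.
Proof.
move=> pC; suff [u uS H] : exists2 u, shallow u & forall i, (i < size p)%N -> u * p`_i \in O.
  exists u => // i; have [/H//|ip] := ltnP i (size p).
  by rewrite nth_default// mulr0 rpred0.
elim: (size p) => [|n [u uS IH]]; first by exists 1 => //; exact: shallow1.
have /coarseP[w wS H] := pC n; exists (u * w); first exact: shallowM.
have [_ uO _] := uS; have [_ wO _] := wS.
move=> i; rewrite ltnS leq_eqVlt => /orP[/eqP ->|/IH lt].
  by rewrite -mulrA; apply: rpredM.
by rewrite mulrAC; apply: rpredM; first exact: lt.
Qed.

(** The relative change of [p] is s times a polynomial over the coarse ring, and [u] is a common
    denominator of its coefficients. *)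
Lemma coarse_close (p : {poly K}) : (forall i, p`_i \in coarse) ->
  p.[0] != 0 -> p.[0]^-1 \in coarse ->
  exists2 u, shallow u & forall s, s / u \in M -> p.[s] / p.[0] - 1 \in M.
Proof.
move=> pC p0 pC'; have [_ _ cM] := coarse_closed.
have qC i : (p.[0]^-1 *: drop_poly 1 p)`_i \in coarse.
  by rewrite coefZ coef_drop_poly cM.
have [u uS H] := coarse_den qC; have [u0 uO _] := uS.
exists u => // s su; have sO : s \in O.
  by rewrite -(divfK u0 s); apply: rpredM => //; apply: val_max_ring.
have -> : p.[s] / p.[0] - 1 = s / u * (u *: (p.[0]^-1 *: drop_poly 1 p)).[s].
  have -> : p.[s] = p.[0] + (drop_poly 1 p).[s] * s.
    rewrite -[in LHS](poly_take_drop 1 p) hornerD hornerM hornerXn expr1.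
    congr (_ + _); rewrite (size1_polyC (size_take_poly 1 p)) hornerC.
    by rewrite coef_take_poly horner_coef0.
  by rewrite !hornerZ; field; rewrite u0 p0.
by apply: val_maxMl => //; apply: val_ring_horner => // i; rewrite coefZ.
Qed.


Lemma max_ring_coarse m : (m == 0) || (m^-1 \notin coarse) -> m \in M.
Proof.
rewrite val_maxE => /orP[->//|H]; apply/orP; right.
by apply: contra H; apply: ring_coarse.
Qed.

(** * Failure of Hensel's lemma against quantifier elimination *)

Lemma hensel_failure_no_qe :
  [pchar (residue_field v)] =i pred0 ->
  (forall m k, m \in M -> exists b, 1 + m = b ^+ k.+1) ->
  admits_qe (theory (mac_of_valued_field v)) -> False.
Proof.
move=> char_residue powM qe.
have [R [F [i [pr [inji iA Ai prS pr0]]]]] :=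
  residue_place (ValuationSubring coarse_closed coarse_total).
rewrite /= in iA Ai pr0.
have prM r : pr r = 0 -> i r \in M.
  by move/eqP; rewrite pr0; apply: max_ring_coarse.
have prS0 r : shallow (i r) -> pr r != 0.
  move=> rS; have [r0 _ _] := rS; rewrite pr0 (negPf r0) /= negbK.
  exact: shallow_inv.
have charF n : n.+1%:R != 0 :> F.
  rewrite -(rmorph_nat pr); apply: contra (nat_unit char_residue n) => /eqP/prM.
  by rewrite rmorph_nat.
(* The image of [O] is a valuation ring of the residue field [F]. *)
pose V y := exists2 r, pr r = y & i r \in O.
have V1 : V 1 by exists 1; rewrite ?rmorph1 ?rpred1.
have VB x y : V x -> V y -> V (x - y).
  by move=> [r <- rO] [s <- sO]; exists (r - s); rewrite ?rmorphB ?rpredB.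
have VM x y : V x -> V y -> V (x * y).
  by move=> [r <- rO] [s <- sO]; exists (r * s); rewrite ?rmorphM ?rpredM.
have Vtot x : V x \/ V x^-1.
  have [r <-] := prS x; have [rO|rO] := boolP (i r \in O); first by left; exists r.
  right; have rO' := val_max_ring (val_ringN rO).
  have [s sE] := iA _ (ring_coarse rO'); exists s; last by rewrite sE.
  have rs : r * s = 1.
    apply: inji; rewrite rmorphM sE rmorph1 divff//.
    by apply: contraNneq rO => ->; apply: rpred0.
  have r0 : pr r != 0.
    by apply/eqP => r0; have := congr1 pr rs; rewrite rmorphM r0 mul0r rmorph1 => /eqP; rewrite eq_sym oner_eq0.
  by apply: (mulfI r0); rewrite -rmorphM rs rmorph1 divff.
have [liftK liftKP] : exists l : K -> R, forall x, x \in O -> i (l x) = x.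
  have /choice[l lP] : forall x, exists r, x \in O -> i r = x.
    move=> x; have [xO|xO] := boolP (x \in O); last by exists 0.
    by have [r rx] := iA _ (ring_coarse xO); exists r.
  by exists l.
have /choice[liftF liftFP] := prS.
pose fR : {poly R} := \poly_(j < size f) liftK f`_j.
have ifR : map_poly i fR = f.
  apply/polyP => j; rewrite coef_map coef_poly; case: ltnP => [_|jf]; first exact: liftKP.
  by rewrite [RHS]nth_default//; exact: rmorph0.
have ifRE r : i fR.[r] = f.[i r] by rewrite -horner_map ifR.
(* [B] is the image of the residue disc of [a]. The image [z] of f(a) serves as a radius, and its
   inverse shows that [V] is proper. *)
pose B y := exists2 r, i r - a \in M & pr r = y.
pose z := pr (liftK f.[a]).
have faO := val_max_ring fa.
have faS : shallow f.[a] by apply: shallow_horner; rewrite subrr val_max0.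
have z0 : z != 0 by rewrite prS0// liftKP.
have Vz : ~ V z^-1.
  move=> [r rz rO]; have /prM : pr (r * liftK f.[a] - 1) = 0.
    by rewrite rmorphB rmorphM rz mulVf// rmorph1 subrr.
  rewrite rmorphB rmorphM rmorph1 liftKP// => H.
  have : i r * f.[a] - (i r * f.[a] - 1) \in M by rewrite val_maxD ?val_maxN// val_maxM.
  by rewrite opprB addrC subrK (negPf (val_max1 v)).
have BV b : B b -> V b by move=> [r ra <-]; exists r => //; apply: disc_ring.
have Bball b c : B b -> V ((b - c) / z) -> B c.
  move=> [r ra rb] [w wz wO]; exists (r - w * liftK f.[a]); last first.
    by rewrite rmorphB rmorphM rb wz divfK// opprB addrC subrK.
  rewrite rmorphB rmorphM liftKP// addrAC val_maxD// val_maxN// val_maxM//.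
have Broot b : B b -> (map_poly pr fR).[b] != 0.
  by move=> [r ra <-]; rewrite horner_map prS0// ifRE; apply: shallow_horner.
have fR0 : map_poly pr fR != 0.
  have Ba : B (pr (liftK a)) by exists (liftK a); rewrite // liftKP// subrr val_max0.
  by apply: contraNneq (Broot _ Ba) => ->; rewrite horner0.
(* A nonzero [d] lifts to a unit [e] of the coarse ring; its value is at most that of a shallow
   element, hence of some f(b). *)
have fRd : dense_on V B (map_poly pr fR).
  move=> d d0; have [e ed] := prS d.
  move: d0; rewrite -ed pr0 negb_or negbK => /andP[e0 /coarseP[u [u0 uO [b ba bu]] ue]].
  have bO := disc_ring ba.
  have weO : f.[b] / i e \in O.
    have -> : f.[b] / i e = f.[b] / u * (u / i e) by field; rewrite u0 e0.
    exact: rpredM.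
  exists (pr (liftK b)); first by exists (liftK b); rewrite ?liftKP.
  exists (liftK (f.[b] / i e)); last by rewrite liftKP.
  have d0 : pr e != 0.
    rewrite pr0 negb_or e0 negbK; apply/coarseP; exists u => //.
    by split=> //; exists b.
  apply: (mulIf d0); rewrite divfK// -rmorphM horner_map; congr (pr _); apply: inji.
  by rewrite rmorphM ifRE !liftKP// divfK.
have [g [n [girr gm sg gd]]] :=
  irreducible_dense V1 VB VM Vtot Vz z0 BV Bball fR0 Broot fRd.
have [psi [qf _ psiP]] := qe (has_root_formula n.+2).
have {}psiP e := psiP (mac_of_valued_field v) (fun h Th => Th.2) e.
(* Atoms vanishing on all integer tuples stay 0 by [zero_term]; the others are kept away from 0
   together, through their product. *)
pose ts := List.filter (fun t => `[< nonzero_term n.+2 t >]) (atoms psi).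
have [|gs [gsm ssg gsr gsd tgs]] :=
  perturb_dense V1 VB VM Vtot charF girr gm sg gd (t := tprod ts).
  by apply: nonzero_tprod => t /List.filter_In[_ /asboolP].
(* The leading coefficient is no variable of the formula; [q] and [Q] lift the lower ones to [R] and
   [K]. *)
pose gl : {poly F} := gs - 'X^(n.+2).
pose q : {poly R} := \poly_(j < n.+2) liftF gl`_j.
have sgs : (size gl <= n.+2)%N.
  apply/leq_sizeP => j nj; rewrite coefB coefXn.
  move: nj; rewrite leq_eqVlt => /orP[/eqP <-|nj].
    by move: gsm; rewrite monicE lead_coefE ssg /= => /eqP ->; rewrite eqxx subrr.
  by rewrite gtn_eqF// subr0 nth_default// ssg.
have prq : map_poly pr q = gl.
  apply/polyP => j; rewrite coef_map coef_poly; case: ltnP => [_|nj]; first exact: liftFP.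
  by rewrite [RHS]nth_default ?(leq_trans sgs)//; exact: rmorph0.
pose Q := map_poly i q.
have sQ : (size Q <= n.+2)%N by apply: leq_trans (size_poly _ _) (size_poly _ _).
(* A root would be integral over the coarse ring, hence lie in it, and reduce to a root of [gs]. *)
have nrQ : ~ exists x, root ('X^(n.+2) + Q) x.
  move=> [x xQ]; have [c1 cB cM] := coarse_closed.
  have : x \in coarse.
    apply: (@monic_integral _ (fun x => x \in coarse) _ x c1 _ _ _ _ _ xQ).
    - by move=> x1 x2; apply: cB.
    - by move=> x1 x2; apply: cM.
    - exact: coarse_total.
    - by rewrite monicE lead_coefDl ?size_polyXn ?ltnS// lead_coefXn.
    - move=> j; have -> : ('X^(n.+2) + Q)`_j = i ('X^(n.+2) + q)`_j.
        by rewrite !coefD coef_map rmorphD !coefXn rmorph_nat.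
      exact: Ai.
  move/iA => [r rx]; move: xQ; rewrite -rx /root hornerD hornerXn horner_map -rmorphXn -rmorphD.
  move=> /eqP H; have qr : r ^+ n.+2 + q.[r] = 0 by apply: inji; rewrite H rmorph0.
  have := gsr (pr r); rewrite /root -(subrK 'X^(n.+2) gs) -/gl -prq hornerD hornerXn horner_map.
  by rewrite -rmorphXn -rmorphD addrC qr rmorph0 eqxx.
have tQ t : teval (nth 0 Q) t = i (teval (nth 0 q) t).
  by rewrite teval_rmorph; congr teval; apply: funext => j; rewrite /= coef_map.
(* The value of [t] as a polynomial in the increment of the constant coefficient. *)
pose T t := teval (fun j => (q`_j)%:P + ((1 : {poly R})`_j)%:P * 'X) t.
have TE t s : i (T t).[s] = teval (nth 0 (Q + i s *: 1)) t.
  rewrite -teval_line teval_rmorph; congr teval; apply: funext => j /=.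
  by rewrite !coefD !coefZ coef_map rmorphD rmorphM !coef1 rmorph_nat.
(* Each term of [ts] is a unit of the coarse ring at [Q], so [coarse_close] bounds the increment;
   the bounds are multiplied. *)
have [u uS uT] : exists2 u, shallow u & forall t, List.In t ts ->
    forall s, i s / u \in M -> close v (teval (nth 0 Q) t) (teval (nth 0 (Q + i s *: 1)) t).
  have : forall t, List.In t ts -> pr (teval (nth 0 q) t) != 0.
    move=> t tts; have := tprod_neq0 tgs tts; rewrite teval_rmorph -/gl -prq.
    by congr (_ != _); congr teval; apply: funext => j; rewrite /= coef_map.
  elim: ts {tgs} => /= [_|t ts' IH H]; first by exists 1 => //; exact: shallow1.
  have [|u uS uT] := IH; first by move=> t' ?; apply: H; right.
  have := H t (or_introl erefl); rewrite pr0 negb_or negbK => /andP[t0 t1].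
  have T0 : (map_poly i (T t)).[0] = i (teval (nth 0 q) t).
    by rewrite -(rmorph0 i) horner_map TE rmorph0 scale0r addr0 tQ.
  have [|||w wS wT] := @coarse_close (map_poly i (T t)); rewrite ?T0//.
    by move=> j; rewrite coef_map; exact: Ai.
  have [u0 uO _] := uS; have [w0 wO _] := wS.
  exists (u * w); first exact: shallowM.
  move=> t' [<-|t'ts] s suw.
    right; split; first by rewrite tQ.
    rewrite tQ -TE -T0 -horner_map; apply: wT.
    have -> : i s / w = i s / (u * w) * u by field; rewrite u0 w0.
    exact: val_maxMl.
  apply: uT => //.
  have -> : i s / u = i s / (u * w) * w by field; rewrite u0 w0.
  exact: val_maxMl.
have [u0 uO _] := uS.
(* The extra factor f(a), which is in [M], will put the increment divided by [u] into [M] and not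
   merely into [O]. *)
have [|b [rb rbE rbO] [w wE wO]] := gsd (pr (liftK (u * f.[a]))).
  by apply: prS0; rewrite liftKP ?rpredM//; apply: shallowM.
(* The increment of the constant coefficient which makes [rb] a root. *)
pose s := - (rb ^+ n.+2 + q.[rb]).
have su : i s / u \in M.
  have : pr (- s - w * liftK (u * f.[a])) = 0.
    rewrite opprK rmorphB rmorphM wE divfK; last first.
      by apply: prS0; rewrite liftKP ?rpredM//; apply: shallowM.
    rewrite rmorphD rmorphXn rbE -horner_map rbE prq /gl.
    by rewrite hornerD hornerN hornerXn [_ + (_ - _)]addrC subrK subrr.
  set m := _ - _ => m0.
  have sE : i s = - (i m + i w * (u * f.[a])).
    rewrite -[u * f.[a]]liftKP ?rpredM// -rmorphM -rmorphD -rmorphN.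
    by congr (i _); rewrite /m subrK opprK.
  (* If u/m were in [O], then 1/m would be in the coarse ring, but [m] reduces to 0. *)
  have muM : i m / u \in M.
    have := pr0 m; rewrite m0 eqxx => /esym/orP[/eqP ->|H].
      by rewrite mul0r val_max0.
    rewrite val_maxE; apply/orP; right; apply: contra H; rewrite invfM invrK mulrC => H.
    by apply/coarseP; exists u.
  have -> : i s / u = - (i m / u + i w * f.[a]) by rewrite sE; field.
  by rewrite val_maxN// val_maxD// val_maxM.
pose Qs : {poly K} := Q + i s *: 1.
have sQs : (size Qs <= n.+2)%N.
  apply: (leq_trans (size_polyD _ _)); rewrite geq_max sQ.
  by apply: (leq_trans (size_scale_leq _ _)); rewrite size_poly1.
have close_psi : satisfies (M := mac_of_valued_field v) (nth 0 Q) psi <->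
     satisfies (M := mac_of_valued_field v) (nth 0 Qs) psi.
  apply: satisfies_close => // t tat.
  have [nzt|zt] := pselect (nonzero_term n.+2 t).
    by apply: uT => //; apply/List.filter_In; split=> //; apply/asboolP.
  by left; split; apply: (zero_term (nat_neq0 char_residue) zt).
(* The formula holds at [Qs], which has the root [i rb], and therefore at [Q]. *)
apply: nrQ; apply/(has_root_formulaP v sQ)/psiP/close_psi/psiP/has_root_formulaP => //.
exists (i rb); rewrite /root !hornerD hornerXn hornerZ hornerC mulr1 addrA horner_map.
by rewrite -rmorphXn -!rmorphD subrr rmorph0.
Qed.

End HenselFailure.

(** * Henselianity of the valuation *)

Theorem theorem3p10 (K : fieldType) (G : oagType) (v : valuation K G)
    (charK : [pchar K] =i pred0)
    (char_residue : [pchar (residue_field v)] =i pred0)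
    (qe : admits_qe (theory (mac_of_valued_field v)))
    (pro2 : prohenselian v 2) :
  henselian v.
Proof.
move=> f a fO aO fa f'a; apply: contrapT => nr.
have maxE x : max_ideal [set` val_ring v]%classic x <-> x \in val_max v.
  rewrite val_maxE; split=> [[xO H]|].
    by have [//|x0] := eqVneq x 0; apply/negP => xO'; apply: H.
  have [->|x0 /= xO] := eqVneq x 0; first by split=> [|[]]; rewrite ?eqxx //=; exact: rpred0.
  split; first by have [//|H] := val_ring_total v x; rewrite H in xO.
  by case=> _ H; rewrite H in xO.
have O0 : [set` val_ring v]%classic 0 by exact: rpred0.
have fO' := (polyOver_coef f O0).1 fO.
apply: (@hensel_failure_no_qe K G v f a fO' aO) => //.
- exact/maxE.
- by apply/negP => /maxE.
- move=> b ba; apply/eqP => fb; apply: nr; exists b; split=> //; last exact/maxE.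
  by apply: disc_ring ba.
(* [prohenselian] speaks of nonzero elements, so m = 0 is treated apart. *)
- move=> m k mM; have [->|m0] := eqVneq m 0; first by exists 1; rewrite addr0 expr1n.
  exact: (one_add_max_pow char_residue mM m0 pro2).
Qed.
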